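(* Consider the marker-and-cell (staggered grid) discretization of the rescaled unsteady Stokes problem with Dirichlet boundary conditions on a fixed rectangle, with $A=I-\epsilon^2L$, $\epsilon>0$, $S=-DA^{-1}G$ and $\mathbb S^{-1}=(-L^c)^{-1}+\epsilon^2I$ (all defined in the context), and let $$M=\begin{bmatrix}A&G\\-D&0\end{bmatrix},\qquad P_1^{-1}=\begin{bmatrix}I&-G\\0&I-\epsilon^2L^c\end{bmatrix}\begin{bmatrix}I&0\\0&(-L^c)^{-1}\end{bmatrix}\begin{bmatrix}I&0\\-D&-I\end{bmatrix}\begin{bmatrix}A^{-1}&0\\0&I\end{bmatrix}$$ act on $\mathbf U\times\mathbf P$. Let $\beta>0$ be a constant, independent of the mesh refinement, for which the discrete inf-sup condition $$\sup_{0\ne\mathbf u\in\mathbf U}\frac{(-D\mathbf u,p)_0}{\|\mathbf u\|_1}\ \ge\ \beta\,\|p\|_0\qquad\text{for all } p\in\mathbf P$$ holds. Then the eigenvalues of the preconditioned operator $P_1^{-1}M$ have uniform positive lower and upper bounds which are independent of the mesh refinement and of the parameter $\epsilon$. More precisely, every eigenvalue $\lambda$ of $\mathbb S^{-1}S$ on $\mathbf P$ satisfies $\beta^2\le\lambda\le1$.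
   Context: The rectangle is divided into $n_x\times n_y$ square cells of side $h$, with integers $n_x,n_y\ge2$; mesh refinement means $h\to0$ with the rectangle fixed. For $m\ge2$, let $B_D^{(m)}$ be the $m\times(m-1)$ matrix with entries $-1$ on the main diagonal, $1$ on the first subdiagonal and $0$ elsewhere. Put $T_D^{(m)}=(B_D^{(m)})^TB_D^{(m)}$, $T_N^{(m)}=B_D^{(m)}(B_D^{(m)})^T$, and $T_E^{(m)}=T_N^{(m)}+2E_0^{(m)}$, where $E_0^{(m)}=\mathrm{diag}(1,0,\dots,0,1)$ of size $m\times m$. The velocity space is $\mathbf U=\mathbb R^{(n_x-1)n_y}\times\mathbb R^{n_x(n_y-1)}$ (face-centered velocities, lexicographic order with $x$ index fastest), and $\mathbf P\subset\mathbb R^{n_xn_y}$ is the space of cell-centered pressures with mean value $0$. The discrete vector Laplacian $L$, divergence $D$ and gradient $G$ are $$-L=\frac1{h^2}\begin{bmatrix} I_{n_y}\otimes T_D^{(n_x)}+T_E^{(n_y)}\otimes I_{n_x-1}&0\\0&I_{n_y-1}\otimes T_E^{(n_x)}+T_D^{(n_y)}\otimes I_{n_x}\end{bmatrix},$$ $$-D=G^*=\frac1h\begin{bmatrix}I_{n_y}\otimes B_D^{(n_x)}& B_D^{(n_y)}\otimes I_{n_x}\end{bmatrix},\qquad G=(G^* )^T,$$ and $L^c=DG$ is the discrete pressure Laplacian, which is invertible on $\mathbf P$. Norms: $(p,q)_0=h^2\,p^Tq$, $\|p\|_0^2=(p,p)_0$, $(\mathbf u,\mathbf v)_{\mathbf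 U}=h^2\,\mathbf u^T\mathbf v$, and $\|\mathbf u\|_1^2=(-L\mathbf u,\mathbf u)_{\mathbf U}$. The parameter is $\epsilon^2=\mu\Delta t/\rho$, where $\mu$ is the viscosity, $\rho$ the density and $\Delta t$ the time step (the discrete backward Euler Stokes system has been multiplied by $\Delta t/\rho$ and the factor absorbed into the pressure). It is known that for a fixed rectangle an inf-sup constant $\beta>0$ independent of $h$ exists. *)

(* Defs.v *)
From HB Require Import structures.
From mathcomp Require Import all_boot all_order all_algebra.
From mathcomp Require Import mxtens complex.
From mathcomp Require Import all_classical all_reals ereal.

Set Implicit Arguments.
Unset Strict Implicit.
Unset Printing Implicit Defensive.

Import Order.TTheory GRing.Theory Num.Theory.

Local Open Scope ring_scope.

(* All operators are defined over an arbitrary field: the inf-sup condition   *)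
(* uses them over the reals, the spectra use them over R[i], so that          *)
(* eigenvalues of the (non-symmetric) operators are complex a priori.         *)

Section OneDimensional.
Context (F : fieldType).
Implicit Type m : nat.

Definition B_D m : 'M[F]_(m, m.-1) :=
  \matrix_(i, j) ((i == j.+1 :> nat)%:R - (i == j :> nat)%:R).

Definition T_D m : 'M[F]_m.-1 := (B_D m)^T *m B_D m.

Definition T_N m : 'M[F]_m := B_D m *m (B_D m)^T.

Definition E_0 m : 'M[F]_m :=
  diag_mx (\row_i ((i == 0%N :> nat) || (i == m.-1 :> nat))%:R).

Definition T_E m : 'M[F]_m := T_N m + 2 *: E_0 m.

End OneDimensional.

(* The Kronecker product [*t] makes the index of its right factor the fastest *)
(* one, i.e. the x index below.                                               *)
Notation velocity F nx ny := 'cV[F]_(ny * nx.-1 + ny.-1 * nx).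

Definition mean (F : fieldType) (n : nat) : 'Hom('cV[F]_n, 'cV[F]_1) :=
  linfun (mulmx (const_mx n%:R^-1 : 'rV[F]_n)).

Definition pressure (F : fieldType) (nx ny : nat) : {vspace 'cV[F]_(ny * nx)} :=
  lker (mean F (ny * nx)).

Lemma meanE (F : fieldType) (n : nat) (p : 'cV[F]_n) :
  mean F n p 0 0 = (\sum_i p i 0) / n%:R.
Proof.
rewrite lfunE /= mxE mulr_suml; apply: eq_bigr => i _.
by rewrite mxE mulrC.
Qed.

Notation pressureT F nx ny := (subvs_of (pressure F nx ny)).

Section Mac.
Context (F : fieldType) (nx ny : nat) (h : F).

Definition negL_mx : 'M[F]_(ny * nx.-1 + ny.-1 * nx) :=
  h ^- 2 *: block_mx
    ((1%:M : 'M_ny) *t T_D F nx + T_E F ny *t (1%:M : 'M_nx.-1)) 0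
    0 ((1%:M : 'M_ny.-1) *t T_E F nx + T_D F ny *t (1%:M : 'M_nx)).

Definition Gstar_mx : 'M[F]_(ny * nx, ny * nx.-1 + ny.-1 * nx) :=
  h^-1 *: row_mx ((1%:M : 'M_ny) *t B_D F nx) (B_D F ny *t (1%:M : 'M_nx)).

Definition lapU : 'End(velocity F nx ny) := linfun (mulmx (- negL_mx)).

Definition grad : 'Hom(pressureT F nx ny, velocity F nx ny) :=
  linfun (fun p => Gstar_mx^T *m vsval p).

(* The projection onto the mean-zero pressures only changes the type: the     *)
(* range of the divergence matrix is already contained in them, see divE.     *)
Definition div : 'Hom(velocity F nx ny, pressureT F nx ny) :=
  linfun (fun u => vsproj (pressure F nx ny) (- Gstar_mx *m u)).

Definition lapP : 'End(pressureT F nx ny) := (div \o grad)%VF.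

Lemma sum_B_D m (j : 'I_m.-1) : \sum_i B_D F m i j = 0.
Proof.
case: m j => [|m] j /=; first by case: j.
under eq_bigr do rewrite mxE.
rewrite sumrB [X in _ - X](bigD1 (widen_ord (leqnSn m) j)) //=.
rewrite (bigD1 (lift ord0 j)) //= !eqxx !big1 ?addr0 ?subrr //.
  by move=> i /negPf; rewrite -val_eqE /= => ->.
by move=> i /negPf; rewrite -val_eqE /= /bump leq0n add1n => ->.
Qed.

Lemma sum_tens m n p q (A : 'M[F]_(m, n)) (B : 'M[F]_(p, q)) k l :
  \sum_i (A *t B) i (mxtens_index (k, l)) = (\sum_i A i k) * (\sum_j B j l).
Proof.
rewrite mulr_sum; apply: eq_bigr => i _.
by rewrite mxE !mxtens_indexK.
Qed.

Lemma div_pressure (u : velocity F nx ny) : - Gstar_mx *m u \in pressure F nx ny.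
Proof.
rewrite memv_ker; apply/eqP/matrixP => i j; rewrite !ord1 meanE [RHS]mxE.
have Gsum k : \sum_i Gstar_mx i k = 0.
  under eq_bigr do rewrite mxE.
  rewrite -mulr_sumr; case: (splitP k) => l kl.
    have -> : k = lshift _ l by apply: val_inj.
    under eq_bigr do rewrite row_mxEl.
    by case: (mxtens_indexP l) => *; rewrite sum_tens sum_B_D !mulr0.
  have -> : k = rshift _ l by apply: val_inj.
  under eq_bigr do rewrite row_mxEr.
  by case: (mxtens_indexP l) => *; rewrite sum_tens sum_B_D mul0r mulr0.
under eq_bigr do rewrite mulNmx !mxE.
rewrite sumrN exchange_big /= big1 ?oppr0 ?mul0r // => k _.
by rewrite -mulr_suml Gsum mul0r.
Qed.

Lemma gradE p : grad p = Gstar_mx^T *m vsval p.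
Proof.
pose f : {linear pressureT F nx ny -> velocity F nx ny} :=
  mulmx Gstar_mx^T \o vsval.
exact: (lfunE f).
Qed.

Lemma divE u : vsval (div u) = - Gstar_mx *m u.
Proof.
pose f : {linear velocity F nx ny -> pressureT F nx ny} :=
  vsproj (pressure F nx ny) \o mulmx (- Gstar_mx).
have -> : div u = f u by exact: (lfunE f).
by rewrite /= vsprojK // div_pressure.
Qed.

End Mac.

(* [f1 f2; f3 f4], acting on pairs *)
Definition block_lfun (F : fieldType) (V1 V2 W1 W2 : vectType F)
    (f1 : 'Hom(V1, W1)) (f2 : 'Hom(V2, W1))
    (f3 : 'Hom(V1, W2)) (f4 : 'Hom(V2, W2)) : 'Hom((V1 * V2)%type, (W1 * W2)%type) :=
  linfun (fun x => (f1 x.1 + f2 x.2, f3 x.1 + f4 x.2)).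

Lemma block_lfunE (F : fieldType) (V1 V2 W1 W2 : vectType F)
    (f1 : 'Hom(V1, W1)) (f2 : 'Hom(V2, W1))
    (f3 : 'Hom(V1, W2)) (f4 : 'Hom(V2, W2)) x :
  block_lfun f1 f2 f3 f4 x = (f1 x.1 + f2 x.2, f3 x.1 + f4 x.2).
Proof.
pose f (y : (V1 * V2)%type) : (W1 * W2)%type := (f1 y.1 + f2 y.2, f3 y.1 + f4 y.2).
have f_lin : linear f.
  move=> c y z; rewrite [RHS]surjective_pairing /= /f !linearP /=.
  by congr pair; rewrite scalerDr addrACA.
pose fL : {linear (V1 * V2)%type -> (W1 * W2)%type} := HB.pack f
  (GRing.isLinear.Build F (V1 * V2)%type (W1 * W2)%type *:%R f f_lin).
exact: (lfunE fL).
Qed.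

Section Stokes.
Context (F : fieldType) (nx ny : nat) (h eps : F).

Local Notation U := (velocity F nx ny).
Local Notation P := (pressureT F nx ny).
Local Notation D := (div nx ny h).
Local Notation G := (grad nx ny h).
Local Notation Lc := (lapP nx ny h).

(* [f^-1] on endomorphisms is a total pseudo-inverse; it is the inverse when  *)
(* f is injective, as are [velA] and [- Lc] for h, eps > 0.                   *)
Definition velA : 'End(U) := \1%VF - eps ^+ 2 *: lapU nx ny h.

Definition schur : 'End(P) := - (D \o velA^-1 \o G)%VF.

Definition schur_prec : 'End(P) := (- Lc)^-1%VF + eps ^+ 2 *: \1%VF.

Definition stokesM : 'End((U * P)%type) := block_lfun velA G (- D) 0.

Definition P1inv : 'End((U * P)%type) :=
  (block_lfun \1 (- G) 0 (\1 - eps ^+ 2 *: Lc) \o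
   block_lfun \1 0 0 (- Lc)^-1 \o
   block_lfun \1 0 (- D) (- \1) \o
   block_lfun velA^-1 0 0 \1)%VF.

End Stokes.

(* The meshes of the fixed rectangle of sides a and b. *)
Record mesh (R : realType) (a b : R) := Mesh {
  nx : nat;
  ny : nat;
  h : R;
  nx_ge2 : (2 <= nx)%N;
  ny_ge2 : (2 <= ny)%N;
  h_gt0 : 0 < h;
  mesh_width : nx%:R * h = a;
  mesh_height : ny%:R * h = b
}.

Section InfSup.
Context (R : realType) (a b : R) (g : mesh a b).

Definition inner n (x y : 'cV[R]_n) : R := h g ^+ 2 * (x^T *m y) 0 0.

Definition norm0 (p : pressureT R (nx g) (ny g)) : R :=
  Num.sqrt (inner (vsval p) (vsval p)).

Definition norm1 (u : velocity R (nx g) (ny g)) : R :=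
  Num.sqrt (inner ((- lapU (nx g) (ny g) (h g)) u) u).

Definition inf_sup (beta : R) : Prop :=
  forall p : pressureT R (nx g) (ny g),
    ((beta * norm0 p)%:E <=
     ereal_sup [set (inner (vsval ((- div (nx g) (ny g) (h g)) u)) (vsval p)
                     / norm1 u)%:E | u in [set u | u != 0%R]])%E.

End InfSup.

Section Spectra.
Context (R : realType) (a b : R) (g : mesh a b).
Local Open Scope complex_scope.

Definition eigenvalue_P1M (eps : R) : pred R[i] :=
  passmx.leigenvalue (P1inv (nx g) (ny g) (h g)%:C eps%:C \o
                      stokesM (nx g) (ny g) (h g)%:C eps%:C)%VF.

Definition eigenvalue_schur (eps : R) : pred R[i] :=
  passmx.leigenvalue (schur_prec (nx g) (ny g) (h g)%:C eps%:C \o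
                      schur (nx g) (ny g) (h g)%:C eps%:C)%VF.

End Spectra.

(* Main.v *)
Require Import Defs.
From mathcomp Require Import all_boot all_order all_algebra.
From mathcomp Require Import mxtens complex ring lra.
From mathcomp Require Import all_classical all_reals ereal trigo.

Set Implicit Arguments.
Unset Strict Implicit.
Unset Printing Implicit Defensive.

Import Order.TTheory GRing.Theory Num.Theory.

Local Open Scope ring_scope.
Local Open Scope complex_scope.

(* If T_E were T_N, all the operators would be diagonal in the cosine/sine    *)
(* bases and S would be inverse to its preconditioner. The difference 2 E_0   *)
(* only involves the tangential traces of the velocity on the sides of the    *)
(* rectangle. Eliminating the interior, the inf-sup condition with constant   *)
(* beta says that a quadratic form F_0 of the traces is nonnegative, and the  *)
(* bound beta^2 <= lambda follows from the nonnegativity of a similar form    *)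
(* F_d, where d = h^2 / eps^2 and 1 / k^2 is replaced with 1 / (k (k + d)) for *)
(* every mode of eigenvalue k = s + t. To compare them, evaluate F_0 at the   *)
(* traces whose coefficients are multiplied by sqrt (2 s / (2 s + d)). The    *)
(* mode by mode loss is of the sign of t - s and is absorbed, after summation *)
(* over t, in the diagonal part of the form: this uses                        *)
(*   sum_j 4 c_j(0)^2 (s - t_j) / (s + t_j)^2 <= 2                            *)
(* over the cosine modes c_j of a given parity, which is a discrete Rellich   *)
(* identity for the solution of (T_N + s) v = e_first +- e_last, as well as   *)
(* beta^2 <= 1/2, which F_0 >= 0 yields for suitable traces. That lambda is   *)
(* real and at most 1 results from the symmetry and the positivity of A and N. *)

(** Take h out of the operators and put d = h^2 / eps^2; N and Gs stand for the scaled -L and G^* .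
    An eigenvector p of the Schur problem for mu yields u = A^-1 G p and a potential phi whose
    gradient has the same divergence as u. In Fourier modes the energy ((d + N) u, u) is Phi + Om +
    2 T, the divergence, curl and trace parts, and testing the equation with u gives mu (Phi + Om +
    2 T) = Phi, so that 0 <= mu <= 1. Mode by mode, the equation also ties the curl and the
    divergence of u to its tangential traces. Hence F_d, evaluated at the traces of u, satisfies
    mu^2 F_d = (1 - mu) (mu - lam) Phi with lam = beta^2, and the lower bound amounts to F_d >= 0:
    this is [eigen_bounds].

    The inf-sup condition gives F_0 >= 0 ([inf_sup_fourier]); [boundary_form_ge0] carries this over
    to d > 0, using the Rellich estimate [cosmx_row_sum] and lam <= 1/2
    ([discrete_inf_sup_le_half]).

    Symmetry of the operators makes the complex eigenvalues real ([complex_eigen_bounds]). Finally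
    P_1^-1 M is block triangular with diagonal blocks I and S^-1 S ([P1M_eigenvalue]), so only the
    value 1 can join the spectrum of the Schur problem. *)

Section PairForm.
Context (R : rcfType) (gam : R).

(* With s, t the eigenvalues of T_N attached to a Fourier mode, x and y are   *)
(* its contributions from the traces on the horizontal and on the vertical    *)
(* sides; the two squares are the curl and the divergence parts.              *)
Definition pair_form (d s t x y : R) : R :=
  4 * (gam * (Num.sqrt t * x - Num.sqrt s * y) ^+ 2 -
       (1 - gam) * (Num.sqrt s * x + Num.sqrt t * y) ^+ 2) /
  ((s + t) * (s + t + d)).

Definition shrink (d s : R) := Num.sqrt (2 * s / (2 * s + d)).

(* The factors [shrink d s], [shrink d t] are those for which both forms      *)
(* agree when s = t, whence the factor t - s in the loss.                     *)
Lemma pair_form_shrink (d s t x y : R) : 0 < d -> 0 < s -> 0 < t ->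
  4 * d * (gam - 2^-1) * (t - s) / ((s + t) * (s + t + d)) *
    (x ^+ 2 / (2 * s + d) - y ^+ 2 / (2 * t + d)) <=
  pair_form d s t x y - pair_form 0 s t (shrink d s * x) (shrink d t * y).
Proof.
move=> d0 s0 t0.
have S0 : 0 < 2 * s + d by lra.
have T0 : 0 < 2 * t + d by lra.
pose S := Num.sqrt (2 * s + d); pose T := Num.sqrt (2 * t + d).
have SE : S ^+ 2 = 2 * s + d by rewrite sqr_sqrtr // ltW.
have TE : T ^+ 2 = 2 * t + d by rewrite sqr_sqrtr // ltW.
have S_gt0 : 0 < S by rewrite sqrtr_gt0.
have T_gt0 : 0 < T by rewrite sqrtr_gt0.
set rs := Num.sqrt s; set rt := Num.sqrt t.
have rsE : rs ^+ 2 = s by rewrite sqr_sqrtr // ltW.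
have rtE : rt ^+ 2 = t by rewrite sqr_sqrtr // ltW.
have rs_gt0 : 0 < rs by rewrite sqrtr_gt0.
have rt_gt0 : 0 < rt by rewrite sqrtr_gt0.
pose r2 : R := Num.sqrt 2.
have r2E : r2 ^+ 2 = 2 by rewrite sqr_sqrtr // ler0n.
have shE z Z : 0 < z -> Z = Num.sqrt (2 * z + d) -> shrink d z = r2 * Num.sqrt z / Z.
  move=> z0 ->; have z2 : 0 <= 2 * z by rewrite mulr_ge0 // ltW.
  rewrite /shrink sqrtrM // sqrtrM // sqrtrV //.
  by rewrite addr_ge0 // ltW.
(* In the variables u = x / S and v = y / T, the shrunk arguments become sqrt 2 times sqrt s u and
   sqrt t v. The terms in [gam] then cancel exactly against the stated loss. *)
have xE : x = S * (x / S) by rewrite mulrC divfK // gt_eqF.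
have yE : y = T * (y / T) by rewrite mulrC divfK // gt_eqF.
move: (x / S) (y / T) xE yE => u v -> ->.
rewrite (shE s S) // (shE t T) // -/rs -/rt -SE -TE.
have -> : (S * u) ^+ 2 / S ^+ 2 = u ^+ 2 by field; lra.
have -> : (T * v) ^+ 2 / T ^+ 2 = v ^+ 2 by field; lra.
have -> : r2 * rs / S * (S * u) = r2 * rs * u by field; lra.
have -> : r2 * rt / T * (T * v) = r2 * rt * v by field; lra.
rewrite /pair_form -/rs -/rt addr0 -subr_ge0.
pose k := s + t; pose q := rs * rt * S * T.
have k0 : 0 < k by rewrite /k; lra.
have q0 : 0 <= q by rewrite /q !mulr_ge0 // ltW.
have q2 : q ^+ 2 = s * t * (2 * s + d) * (2 * t + d).
  by rewrite /q !exprMn rsE rtE SE TE.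
have qub : 2 * q <= s * (2 * t + d) + t * (2 * s + d).
  have : 0 <= (rs * T - rt * S) ^+ 2 by exact: sqr_ge0.
  have -> : (rs * T - rt * S) ^+ 2 = rs ^+ 2 * T ^+ 2 + rt ^+ 2 * S ^+ 2 - 2 * q.
    by rewrite /q; ring.
  by rewrite rsE rtE SE TE; lra.
have qlb : 2 * (k + d) * (s * t) <= k * q.
  rewrite -ler_sqr ?nnegrE; first last.
  - by apply: mulr_ge0 => //; exact: ltW.
  - by apply: mulr_ge0; [lra | apply: mulr_ge0; exact: ltW].
  rewrite [(k * q) ^+ 2]exprMn q2 -subr_ge0.
  have -> : k ^+ 2 * (s * t * (2 * s + d) * (2 * t + d)) -
     (2 * (k + d) * (s * t)) ^+ 2 = s * t * (s - t) ^+ 2 * (2 * d * k + d ^+ 2).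
    by rewrite /k; ring.
  by apply: mulr_ge0; [apply: mulr_ge0; [apply: mulr_ge0; exact: ltW | exact: sqr_ge0]
    | apply: addr_ge0; [apply: mulr_ge0; [lra|exact: ltW] | exact: sqr_ge0]].
(* Up to a positive factor, what remains is d (s - t)^2 (u^2 + v^2) - 4 u v e, which is nonnegative
   as soon as 0 <= 2 e <= d (s - t)^2. The upper bound comes from the arithmetic-geometric mean
   inequality [qub], the lower one from comparing squares in [qlb]. *)
pose e := k * q - 2 * (k + d) * (s * t).
have e0 : 0 <= e by rewrite /e subr_ge0.
have eub : 2 * e <= d * (s - t) ^+ 2.
  rewrite /e -subr_ge0.
  have -> : d * (s - t) ^+ 2 - 2 * (k * q - 2 * (k + d) * (s * t)) =
    k * (s * (2 * t + d) + t * (2 * s + d) - 2 * q) by rewrite /k; ring.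
  by apply: mulr_ge0; [exact: ltW | rewrite subr_ge0].
have num0 : 0 <= d * (s - t) ^+ 2 * (u ^+ 2 + v ^+ 2) - 4 * (u * v) * e.
  have h : 0 <= 2 * e * (u - v) ^+ 2.
    by apply: mulr_ge0; [lra | exact: sqr_ge0].
  have h2 : 0 <= (d * (s - t) ^+ 2 - 2 * e) * (u ^+ 2 + v ^+ 2).
    by apply: mulr_ge0; [rewrite subr_ge0 | apply: addr_ge0; exact: sqr_ge0].
  by nra.
have sq1 : (rt * (S * u) - rs * (T * v)) ^+ 2 =
    t * (2 * s + d) * u ^+ 2 + s * (2 * t + d) * v ^+ 2 - 2 * q * (u * v).
  by rewrite -SE -TE -rsE -rtE /q; ring.
have sq2 : (rs * (S * u) + rt * (T * v)) ^+ 2 =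
    s * (2 * s + d) * u ^+ 2 + t * (2 * t + d) * v ^+ 2 + 2 * q * (u * v).
  by rewrite -SE -TE -rsE -rtE /q; ring.
have sq3 : (rt * (r2 * rs * u) - rs * (r2 * rt * v)) ^+ 2 =
    2 * s * t * (u - v) ^+ 2 by rewrite -r2E -rsE -rtE; ring.
have sq4 : (rs * (r2 * rs * u) + rt * (r2 * rt * v)) ^+ 2 =
    2 * (s * u + t * v) ^+ 2 by rewrite -r2E -rsE -rtE; ring.
rewrite sq1 sq2 sq3 sq4.
have -> : forall z, z = 2 * (d * (s - t) ^+ 2 * (u ^+ 2 + v ^+ 2) -
    4 * (u * v) * e) / (k ^+ 2 * (k + d)) -> 0 <= z.
- move=> z ->; apply: divr_ge0; first by apply: mulr_ge0.
  by apply: mulr_ge0; [exact: sqr_ge0 | lra].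
- by [].
rewrite /e /k; field.
by apply/andP; split; apply: lt0r_neq0; lra.
Qed.

(** Modes that are constant in one direction carry a single trace contribution; only the negative
    square is left, and it decreases in size faster in d than the shrunk one, so nothing is lost. *)
Lemma pair_form_shrink0l (d s x : R) : 0 < d -> 0 < s -> gam <= 1 ->
  0 <= pair_form d s 0 x 0 - pair_form 0 s 0 (shrink d s * x) (shrink d 0 * 0).
Proof.
move=> d0 s0 g1; rewrite /pair_form sqrtr0 !mulr0 !mul0r !subrr !addr0 expr0n /=.
have th2 : shrink d s ^+ 2 = 2 * s / (2 * s + d).
  by rewrite sqr_sqrtr // divr_ge0 ?addr_ge0 ?mulr_ge0 // ltW.
rewrite !exprMn th2 sqr_sqrtr ?(ltW s0) //.
have -> : forall z, z = 4 * (1 - gam) * d * x ^+ 2 / ((s + d) * (2 * s + d))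
   -> 0 <= z => //.
  move=> z ->; apply: divr_ge0; last by apply: mulr_ge0; lra.
  apply: mulr_ge0; last exact: sqr_ge0.
  by apply: mulr_ge0; last exact: ltW; lra.
by field; rewrite !lt0r_neq0 //; lra.
Qed.

Lemma pair_formC (d s t x y : R) : pair_form d s t x y = pair_form d t s y x.
Proof. by rewrite /pair_form (addrC s t); congr (_ / _); ring. Qed.

End PairForm.

(** * Comparison of the boundary forms for d = 0 and d > 0 *)

Section BoundaryForm.
Context (R : rcfType) (gam : R) (I J : finType).
Context (s c : I -> R) (sig : I -> bool) (t e : J -> R) (tau : J -> bool).

(* [al i b] stands for a_0 + (-1)^b a_1, where a_0 and a_1 are the i-th       *)
(* coefficients of the traces on the two horizontal sides; a mode of parity   *)
(* [tau j] only sees the combination of that parity.                          *)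
Definition boundary_form (d : R) (al : I -> bool -> R) (be : J -> bool -> R) : R :=
  gam * (\sum_i \sum_b al i b ^+ 2 + \sum_j \sum_b be j b ^+ 2) +
  \sum_i \sum_j pair_form gam d (s i) (t j) (e j * al i (tau j)) (c i * be j (sig i)).

End BoundaryForm.

(* Termwise, both factors of (t - s) ((s + t) / (s + t + d) - th) change sign *)
(* at t = s.                                                                  *)
Lemma row_sum_ge (R : realFieldType) (J : finType) (t e : J -> R) (P : pred J)
    (s d : R) :
  (forall j, 0 <= t j) -> 0 < s -> 0 < d ->
  \sum_(j | P j && (0 < t j)) 4 * e j ^+ 2 * (s - t j) / (s + t j) ^+ 2 <= 2 ->
  - 2 <= \sum_(j | P j && (0 < t j))
           4 * e j ^+ 2 * (t j - s) / ((s + t j) * (s + t j + d)).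
Proof.
move=> t_ge0 s0 d0 h.
pose th := 2 * s / (2 * s + d).
have th0 : 0 <= th by rewrite /th divr_ge0 //; lra.
have th1 : th <= 1 by rewrite /th ler_pdivrMr; lra.
apply: (@le_trans _ _ (th * - 2)); first by nra.
apply: (@le_trans _ _ (th * - (\sum_(j | P j && (0 < t j))
   4 * e j ^+ 2 * (s - t j) / (s + t j) ^+ 2))).
  by apply: ler_wpM2l => //; rewrite lerN2.
rewrite -sumrN mulr_sumr; apply: ler_sum => j /andP[_ tj].
rewrite -subr_ge0.
have -> : forall z, z = 4 * e j ^+ 2 * (d * (t j - s) ^+ 2) /
   ((2 * s + d) * (s + t j) ^+ 2 * (s + t j + d)) -> 0 <= z => //.
  move=> z ->; apply: divr_ge0.
    apply: mulr_ge0; first by apply: mulr_ge0; [lra | exact: sqr_ge0].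
    by apply: mulr_ge0; [exact: ltW | exact: sqr_ge0].
  apply: mulr_ge0; last lra.
  by apply: mulr_ge0; [lra | exact: sqr_ge0].
by rewrite /th; field; rewrite !lt0r_neq0 //; lra.
Qed.

(** F_0 is evaluated at the shrunk traces. Shrinking frees a multiple d / (2 s + d) of each diagonal
    square, and this pays for the losses of [pair_form_shrink] once they are summed over the modes
    of one parity in the other direction. *)
Lemma boundary_form_ge0 (R : rcfType) (gam : R) (I J : finType)
    (s c : I -> R) (sig : I -> bool) (t e : J -> R) (tau : J -> bool) :
  (forall i, 0 <= s i) -> (forall j, 0 <= t j) -> 2^-1 <= gam <= 1 ->
  (forall x b, 0 < x -> \sum_(j | (tau j == b) && (0 < t j))
       4 * e j ^+ 2 * (x - t j) / (x + t j) ^+ 2 <= 2) ->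
  (forall x b, 0 < x -> \sum_(i | (sig i == b) && (0 < s i))
       4 * c i ^+ 2 * (x - s i) / (x + s i) ^+ 2 <= 2) ->
  (forall al be, (forall i b, s i = 0 -> al i b = 0) ->
     (forall j b, t j = 0 -> be j b = 0) ->
     0 <= boundary_form gam s c sig t e tau 0 al be) ->
  forall d al be, 0 < d -> (forall i b, s i = 0 -> al i b = 0) ->
     (forall j b, t j = 0 -> be j b = 0) ->
     0 <= boundary_form gam s c sig t e tau d al be.
Proof.
move=> s_ge0 t_ge0 /andP[g12 g1] Gt Gs F0 d al be d0 al0 be0.
pose al' i b := shrink d (s i) * al i b.
pose be' j b := shrink d (t j) * be j b.
have := F0 al' be'; set F0' := boundary_form _ _ _ _ _ _ _ 0 _ _ => F0'_ge0.
have {}F0'_ge0 : 0 <= F0'.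
  by apply: F0'_ge0 => i b i0; rewrite /al' /be' ?al0 ?be0 ?mulr0.
apply: le_trans F0'_ge0 _; rewrite -subr_ge0.
(* The weight is cut off at zero eigenvalues, where [pair_form_shrink0l] shows that there is no
   loss. *)
pose w (x y : R) := if (0 < x) && (0 < y) then (y - x) / ((x + y) * (x + y + d)) else 0.
have row (K : finType) (r f : K -> R) (rho : K -> bool) x z : 0 <= x -> (forall k, 0 <= r k) ->
    (forall b, 0 < x -> \sum_(j | (rho j == b) && (0 < r j))
       4 * f j ^+ 2 * (x - r j) / (x + r j) ^+ 2 <= 2) ->
    (forall b, x = 0 -> z b = 0) ->
    0 <= \sum_b gam * (z b ^+ 2 - (shrink d x * z b) ^+ 2) +
         \sum_k 4 * d * (gam - 2^-1) * w x (r k) * ((f k * z (rho k)) ^+ 2 / (2 * x + d)).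
  move=> x0 r0 G z0.
  have [x00|xn0] := eqVneq x 0.
    by rewrite !big1 ?addr0 // => [k _|b _]; rewrite z0 // ?mulr0 ?expr0n /= ?mul0r ?mulr0 ?subrr ?mulr0.
  have {xn0}x_gt0 : 0 < x by rewrite lt0r xn0.
  rewrite (partition_big rho xpredT) //= -big_split /=.
  apply: sumr_ge0 => b _.
  have sh2 : shrink d x ^+ 2 = 2 * x / (2 * x + d).
    by rewrite sqr_sqrtr // divr_ge0 ?addr_ge0 ?mulr_ge0 // ltW.
  have -> : \sum_(i | rho i == b) 4 * d * (gam - 2^-1) * w x (r i) *
       ((f i * z (rho i)) ^+ 2 / (2 * x + d)) =
     z b ^+ 2 * (d / (2 * x + d)) * (gam - 2^-1) *
       \sum_(i | rho i == b) 4 * f i ^+ 2 * w x (r i).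
    rewrite mulr_sumr; apply: eq_bigr => i /eqP ->; field.
    by apply: lt0r_neq0; lra.
  have -> : \sum_(i | rho i == b) 4 * f i ^+ 2 * w x (r i) =
     \sum_(i | (rho i == b) && (0 < r i)) 4 * f i ^+ 2 * (r i - x) / ((x + r i) * (x + r i + d)).
    rewrite [RHS]big_mkcondr; apply: eq_bigr => i _; rewrite /w x_gt0 /=.
    by case: ifP => _; rewrite ?mulr0 // mulrA.
  have := row_sum_ge r0 x_gt0 d0 (G b x_gt0).
  set Sg := \sum_(_ | _) _ => Sg2.
  rewrite exprMn sh2.
  have -> : gam * (z b ^+ 2 - 2 * x / (2 * x + d) * z b ^+ 2) +
     z b ^+ 2 * (d / (2 * x + d)) * (gam - 2^-1) * Sg =
     z b ^+ 2 * (d / (2 * x + d)) * (gam + (gam - 2^-1) * Sg).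
    by field; apply: lt0r_neq0; lra.
  (* Since Sg >= -2 and gam >= 1/2, the last factor is at least gam - 2 (gam - 1/2) = 1 - gam >=
     0. *)
  apply: mulr_ge0; last by nra.
  by rewrite mulr_ge0 ?sqr_ge0 // divr_ge0 //; lra.
have pair i j : 4 * d * (gam - 2^-1) * w (s i) (t j) * ((e j * al i (tau j)) ^+ 2 / (2 * s i + d))
   + 4 * d * (gam - 2^-1) * w (t j) (s i) * ((c i * be j (sig i)) ^+ 2 / (2 * t j + d)) <=
   pair_form gam d (s i) (t j) (e j * al i (tau j)) (c i * be j (sig i)) -
   pair_form gam 0 (s i) (t j) (e j * al' i (tau j)) (c i * be' j (sig i)).
  rewrite /al' /be' !(mulrCA _ (shrink _ _)).
  have [si0|si0] := eqVneq (s i) 0.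
    rewrite al0 // !mulr0 expr0n /= mul0r mulr0 add0r si0 /w ltxx andbF mulr0 mul0r.
    have [tj0|tj0] := eqVneq (t j) 0.
      by rewrite be0 // /pair_form !mulr0 addr0 subr0 expr0n /= !mulr0 subr0 !mulr0 !mul0r subr0.
    rewrite [X in _ <= X - _]pair_formC [X in _ <= _ - X]pair_formC.
    have := @pair_form_shrink0l R gam d (t j) (c i * be j (sig i)) d0 _ g1.
    by rewrite mulr0; apply; rewrite lt0r tj0 t_ge0.
  have si_gt0 : 0 < s i by rewrite lt0r si0 s_ge0.
  have [tj0|tj0] := eqVneq (t j) 0.
    rewrite be0 // !mulr0 tj0 /w ltxx andbF /= !mulr0 !mul0r addr0.
    have := @pair_form_shrink0l R gam d (s i) (e j * al i (tau j)) d0 si_gt0 g1.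
    by rewrite mulr0.
  have tj_gt0 : 0 < t j by rewrite lt0r tj0 t_ge0.
  apply: le_trans (pair_form_shrink gam _ _ d0 si_gt0 tj_gt0).
  rewrite /w si_gt0 tj_gt0 /= (addrC (t j)) le_eqVlt; apply/orP; left; apply/eqP.
  by field; rewrite !lt0r_neq0 //; lra.
have -> : boundary_form gam s c sig t e tau d al be - F0' =
  \sum_i \sum_b gam * (al i b ^+ 2 - (shrink d (s i) * al i b) ^+ 2) +
  \sum_j \sum_b gam * (be j b ^+ 2 - (shrink d (t j) * be j b) ^+ 2) +
  \sum_i \sum_j (pair_form gam d (s i) (t j) (e j * al i (tau j)) (c i * be j (sig i)) -
   pair_form gam 0 (s i) (t j) (e j * al' i (tau j)) (c i * be' j (sig i))).
  have sumB (K : finType) (f g : K -> bool -> R) : \sum_k \sum_b gam * (f k b - g k b) =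
      gam * \sum_k \sum_b f k b - gam * \sum_k \sum_b g k b.
    rewrite -mulrBr -sumrB mulr_sumr; apply: eq_bigr => k _.
    by rewrite -sumrB mulr_sumr.
  rewrite (sumB _ (fun i b => al i b ^+ 2)) (sumB _ (fun i b => be i b ^+ 2)).
  under [X in _ = _ + X]eq_bigr do rewrite sumrB.
  by rewrite sumrB /F0' /boundary_form /al' /be'; ring.
apply: le_trans (_ : 0 <= \sum_i (\sum_b gam * (al i b ^+ 2 - (shrink d (s i) * al i b) ^+ 2) +
     \sum_j 4 * d * (gam - 2^-1) * w (s i) (t j) * ((e j * al i (tau j)) ^+ 2 / (2 * s i + d))) +
   \sum_j (\sum_b gam * (be j b ^+ 2 - (shrink d (t j) * be j b) ^+ 2) +
     \sum_i 4 * d * (gam - 2^-1) * w (t j) (s i) * ((c i * be j (sig i)) ^+ 2 / (2 * t j + d)))) _.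
  apply: addr_ge0; apply: sumr_ge0 => i _; apply: row => // b x0.
  - exact: Gt.
  - exact: al0.
  - exact: Gs.
  - exact: be0.
rewrite !big_split /= addrACA lerD2l.
rewrite [X in _ + X <= _]exchange_big -big_split /=; apply: ler_sum => i _.
by rewrite -big_split /=; apply: ler_sum => j _; exact: pair.
Qed.

(* The test traces are those for which the curl part vanishes in every mode.  *)
Lemma boundary_form_half (R : rcfType) (gam : R) (I J : finType)
    (s c : I -> R) (sig : I -> bool) (t e : J -> R) (tau : J -> bool) :
  (forall i, 0 <= s i) -> (forall j, 0 <= t j) ->
  (forall i, s i = 0 -> sig i = false) -> (forall j, t j = 0 -> tau j = false) ->
  \sum_i c i ^+ 2 = 1 -> \sum_i (-1) ^+ sig i * c i ^+ 2 = 0 ->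
  \sum_i s i * c i ^+ 2 = 1 ->
  \sum_j e j ^+ 2 = 1 -> \sum_j (-1) ^+ tau j * e j ^+ 2 = 0 ->
  \sum_j t j * e j ^+ 2 = 1 ->
  (forall al be, (forall i b, s i = 0 -> al i b = 0) ->
     (forall j b, t j = 0 -> be j b = 0) ->
     0 <= boundary_form gam s c sig t e tau 0 al be) ->
  2^-1 <= gam.
Proof.
move=> s_ge0 t_ge0 sig0 tau0 c1 cs sc1 e1 es te1 F0.
(* The factor is 2 for opposite parities and 0 for equal ones, so only pairs of modes of opposite
   parities contribute. *)
pose m (b b' : bool) : R := 1 - (-1) ^+ b * (-1) ^+ b'.
have mC b b' : m b b' = m b' b by rewrite /m mulrC.
have := F0 (fun i b => Num.sqrt (s i) * c i * m (sig i) b)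
           (fun j b => Num.sqrt (t j) * e j * m (tau j) b).
have sum_row (K : finType) (r f : K -> R) (rho : K -> bool) :
    (forall k, 0 <= r k) -> \sum_k r k * f k ^+ 2 = 1 ->
    \sum_k \sum_b (Num.sqrt (r k) * f k * m (rho k) b) ^+ 2 = 4.
  move=> r0 rf1; transitivity (4 * \sum_k r k * f k ^+ 2); last by rewrite rf1 mulr1.
  rewrite mulr_sumr; apply: eq_bigr => k _.
  rewrite big_bool /= !exprMn sqr_sqrtr // /m.
  by case: (rho k); rewrite /= ?expr0 ?expr1; ring.
rewrite /boundary_form sum_row // sum_row //.
have -> : \sum_i \sum_j pair_form gam 0 (s i) (t j)
      (e j * (Num.sqrt (s i) * c i * m (sig i) (tau j)))
      (c i * (Num.sqrt (t j) * e j * m (tau j) (sig i))) =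
   \sum_i \sum_j (- 8 * (1 - gam)) * ((c i ^+ 2 * e j ^+ 2) -
      ((-1) ^+ sig i * c i ^+ 2) * ((-1) ^+ tau j * e j ^+ 2)).
  apply: eq_bigr => i _; apply: eq_bigr => j _; rewrite /pair_form addr0 (mC (tau j)).
  have rsE : s i = Num.sqrt (s i) ^+ 2 by rewrite sqr_sqrtr.
  have rtE : t j = Num.sqrt (t j) ^+ 2 by rewrite sqr_sqrtr.
  have -> : Num.sqrt (s i) * (e j * (Num.sqrt (s i) * c i * m (sig i) (tau j))) +
     Num.sqrt (t j) * (c i * (Num.sqrt (t j) * e j * m (sig i) (tau j))) =
     (s i + t j) * (e j * c i * m (sig i) (tau j)).
    by rewrite [in RHS]rsE [in RHS]rtE; ring.
  have -> : Num.sqrt (t j) * (e j * (Num.sqrt (s i) * c i * m (sig i) (tau j))) -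
     Num.sqrt (s i) * (c i * (Num.sqrt (t j) * e j * m (sig i) (tau j))) = 0 by ring.
  have m2 : m (sig i) (tau j) ^+ 2 = 2 * (1 - (-1) ^+ sig i * (-1) ^+ tau j).
    by rewrite /m; case: (sig i); case: (tau j); rewrite /= ?expr0 ?expr1; ring.
  (* At the zero mode the quotient is 0 by the convention on division; the right-hand side vanishes
     too, both parities being even. *)
  have [k0|k0] := eqVneq (s i + t j) 0.
    have [si0 tj0] : s i = 0 /\ t j = 0.
      by move/eqP: k0; rewrite paddr_eq0 // => /andP[/eqP-> /eqP->].
    by rewrite k0 !mul0r invr0 mulr0 sig0 // tau0 //= expr0; ring.
  rewrite [((_ + _) * (_ * m _ _)) ^+ 2]exprMn exprMn m2; field.
  exact: k0.
have -> : \sum_i \sum_j (- 8 * (1 - gam)) * ((c i ^+ 2 * e j ^+ 2) -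
      ((-1) ^+ sig i * c i ^+ 2) * ((-1) ^+ tau j * e j ^+ 2)) =
   - 8 * (1 - gam) * ((\sum_i c i ^+ 2) * (\sum_j e j ^+ 2) -
     (\sum_i (-1) ^+ sig i * c i ^+ 2) * (\sum_j (-1) ^+ tau j * e j ^+ 2)).
  rewrite !big_distrlr /= -sumrB mulr_sumr; apply: eq_bigr => i _.
  by rewrite -sumrB mulr_sumr.
rewrite c1 e1 cs es => h.
suff : 0 <= gam * (4 + 4) + - 8 * (1 - gam) * (1 * 1 - 0 * 0) by lra.
apply: h => [i b ->|j b ->]; by rewrite sqrtr0 !mul0r.
Qed.

(** * The difference matrices, entrywise *)

Section Difference.
Context (F : fieldType) (n : nat).

Lemma sum_ord_delta k (i : nat) (y : nat -> F) :
  \sum_(j < k) (i == j :> nat)%:R * y j = if (i < k)%N then y i else 0.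
Proof.
case: ltnP => [ik|ki].
  rewrite (bigD1 (Ordinal ik)) //= eqxx mul1r big1 ?addr0 // => j.
  by rewrite -val_eqE /= eq_sym => /negPf ->; rewrite mul0r.
rewrite big1 // => j _; rewrite gtn_eqF ?mul0r //.
exact: leq_trans (ltn_ord j) ki.
Qed.

Lemma trB_D_mul (x : nat -> F) (j : 'I_n.+1) :
  ((B_D F n.+2)^T *m (\col_i x i)) j 0 = x j.+1 - x j.
Proof.
rewrite mxE; under eq_bigr => i _ do rewrite !mxE mulrBl ![(nat_of_ord i == _)]eq_sym.
rewrite sumrB !sum_ord_delta ltnS ltn_ord.
by rewrite (ltn_trans (ltn_ord j) (ltnSn _)).
Qed.

Lemma B_D_mul (y : nat -> F) (i : 'I_n.+2) :
  (B_D F n.+2 *m (\col_(j < n.+1) y j)) i 0 =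
  (if i == 0%N :> nat then 0 else y i.-1) - (if i == n.+1 :> nat then 0 else y i).
Proof.
rewrite mxE; under eq_bigr => j _ do rewrite !mxE mulrBl.
rewrite sumrB sum_ord_delta; congr (_ - _).
  case: i => -[|i] /= hi; first by rewrite big1 // => j _; rewrite mul0r.
  under eq_bigr => j _ do rewrite eqSS.
  by rewrite sum_ord_delta -ltnS hi.
have := ltn_ord i; rewrite ltnS leq_eqVlt => /orP[/eqP ->|h].
  by rewrite ltnn eqxx.
by rewrite h ltn_eqF.
Qed.

Lemma T_N_mul (x : nat -> F) (i : 'I_n.+2) :
  (T_N F n.+2 *m (\col_i x i)) i 0 =
  (if i == 0%N :> nat then 0 else x i - x i.-1) -
  (if i == n.+1 :> nat then 0 else x i.+1 - x i).
Proof.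
rewrite /T_N -mulmxA.
have -> : (B_D F n.+2)^T *m (\col_i x i) = \col_(j < n.+1) (x j.+1 - x j).
  by apply/matrixP => j k; rewrite ord1 trB_D_mul mxE.
rewrite (B_D_mul (fun j => x j.+1 - x j)).
by case: i => -[|i] hi.
Qed.

Lemma trmx_T_N m : (T_N F m)^T = T_N F m.
Proof. by rewrite /T_N trmx_mul trmxK. Qed.

End Difference.

(** * A discrete Rellich identity *)

Section RellichIdentity.
Context (R : rcfType) (n : nat) (s sg : R) (V : nat -> R).
Context (s_gt0 : 0 < s) (sg1 : sg = 1 \/ sg = -1) (V0_ge0 : 0 <= V 0).
(* The hypotheses say that (T_N + s) V = e_first + sg e_last.                  *)
Hypothesis rec0 : V 0 - V 1 + s * V 0 = 1.
Hypothesis recS : forall i, (i < n)%N ->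
  2 * V i.+1 - V i - V i.+2 + s * V i.+1 = 0.
Hypothesis reclast : V n.+1 - V n + s * V n.+1 = sg.
Hypothesis Vlast : V n.+1 = sg * V 0.

Let E : R := 1 - s * V 0 - s * V 0 ^+ 2.

(** This is a first integral of the recurrence: its increment is the recurrence times V_i - V_{i+2},
    up to sign. *)
Lemma rellich_invariant i : (i <= n)%N ->
  V i ^+ 2 + V i.+1 ^+ 2 - (2 + s) * (V i * V i.+1) = E.
Proof.
elim: i => [|i IH] hi.
  have -> : V 1 = (1 + s) * V 0 - 1 by have := rec0; lra.
  by rewrite /E; ring.
rewrite -(IH (ltnW hi)); apply/eqP; rewrite -subr_eq0; apply/eqP.
by rewrite -(mulr0 (V i - V i.+2)) -(recS hi); ring.
Qed.

(** By the invariant, s V_i V_{i+1} = (V_i - V_{i+1})^2 - E > 0, so neighbours have the same strict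
    sign, which propagates from V_0. *)
Lemma rellich_gt0 : E < 0 -> forall i, (i <= n.+1)%N -> 0 < V i.
Proof.
move=> E0; have VV i : (i <= n)%N -> 0 < V i * V i.+1.
  move=> /rellich_invariant hE; have : s * (V i * V i.+1) = (V i - V i.+1) ^+ 2 - E.
    by rewrite -hE; ring.
  have := sqr_ge0 (V i - V i.+1) => h1 h2.
  by rewrite -(pmulr_rgt0 _ s_gt0) h2; lra.
elim=> [|i IH] hi.
  by rewrite lt0r V0_ge0 andbT; apply/eqP => V00; have := VV 0 isT; rewrite V00 mul0r ltxx.
by have := VV i hi; rewrite pmulr_rgt0 //; apply: IH; exact: ltnW.
Qed.

Lemma rellich_partial_sum k : (k <= n)%N ->
  s * \sum_(i < k.+1) V i = 1 - (V k - V k.+1).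
Proof.
elim: k => [|k IH] hk; first by rewrite big_ord1; have := rec0; lra.
rewrite big_ord_recr /= mulrDr IH; last exact: ltnW.
by have := recS hk; lra.
Qed.

Lemma rellich_sum : s * \sum_(i < n.+2) V i = 1 + sg.
Proof. by rewrite big_ord_recr /= mulrDr rellich_partial_sum //; have := reclast; lra. Qed.

(* If E < 0, all the values of V are positive, and V_i + V_{i+1} is bounded   *)
(* below by 2 sqrt (- E / s); the sum of the V_i being known, this bounds - E. *)
Lemma rellich_lower : - (1 + sg) ^+ 2 / (s * n.+2%:R ^+ 2) <= E.
Proof.
have m_gt0 : 0 < n.+2%:R :> R by rewrite ltr0n.
have [E0|E0] := leP 0 E.
  apply: le_trans E0; rewrite mulNr oppr_le0 divr_ge0 ?sqr_ge0 //.
  by rewrite mulr_ge0 ?sqr_ge0 // ltW.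
have V_gt0 := rellich_gt0 E0.
case: sg1 => sgE; last first.
  by have := V_gt0 _ (leqnn n.+1); have := V_gt0 0 isT; rewrite Vlast sgE => *; lra.
pose kap := Num.sqrt (- 4 * E / s).
have kap2 : kap ^+ 2 = - 4 * E / s.
  by rewrite sqr_sqrtr // divr_ge0 // ?ltW //; lra.
have pair_ge i : (i <= n)%N -> kap <= V i + V i.+1.
  move=> hi; rewrite -ler_sqr ?nnegrE ?sqrtr_ge0 //; last first.
    by rewrite addr_ge0 // ltW // V_gt0 // ltnW.
  rewrite kap2 ler_pdivrMr // -(rellich_invariant hi).
  have := sqr_ge0 (V i - V i.+1) => h.
  have : 0 <= (4 + s) * (V i - V i.+1) ^+ 2.
    by rewrite mulr_ge0 // addr_ge0 // ltW.
  by nra.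
have Vn : V n.+1 = V 0 by rewrite Vlast sgE mul1r.
have sum2 : s * \sum_(i < n.+2) V i = 2 by rewrite rellich_sum sgE.
(* The sum of all V_i being 2 / s, positivity gives s V_0 <= 1, hence V_1 <= V_0. The resulting
   bound kap <= 2 V_0 supplies the pair (V_{n+1}, V_0) that closes the cyclic sum of neighbours. *)
have V01 : V 1 <= V 0.
  have : 2 * V 0 <= \sum_(i < n.+2) V i.
    rewrite big_ord_recl big_ord_recr /= Vn.
    have : 0 <= \sum_(i < n) V (lift ord0 (widen_ord (leqnSn n) i)).
      by apply: sumr_ge0 => i _; rewrite ltW // V_gt0 //= /bump /= add1n ltnS ltnW.
    by lra.
  move=> h; have : s * (2 * V 0) <= s * \sum_(i < n.+2) V i by rewrite ler_pM2l.
  by rewrite sum2; have := rec0; lra.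
have kap0 : kap <= 2 * V 0 by have := pair_ge 0 isT; lra.
have : n.+2%:R * kap <= 2 * \sum_(i < n.+2) V i.
  have -> : 2 * \sum_(i < n.+2) V i = \sum_(i < n.+1) (V i + V i.+1) + 2 * V 0.
    have S1 : \sum_(i < n.+2) V i = \sum_(i < n.+1) V i + V 0 by rewrite big_ord_recr /= Vn.
    have S2 : \sum_(i < n.+2) V i = V 0 + \sum_(i < n.+1) V i.+1 by rewrite big_ord_recl.
    by rewrite big_split /=; lra.
  rewrite -natr1 mulrDl mul1r lerD //.
  have -> : n.+1%:R * kap = \sum_(i < n.+1) kap by rewrite sumr_const card_ord mulr_natl.
  by apply: ler_sum => i _; apply: pair_ge; rewrite -ltnS.
move=> h.
have {}h : s * (n.+2%:R * kap) <= 4.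
  by apply: le_trans (_ : s * (2 * \sum_(i < n.+2) V i) <= _); [rewrite ler_pM2l | lra].
have {}h : (s * (n.+2%:R * kap)) ^+ 2 <= 4 ^+ 2.
  by rewrite ler_sqr ?nnegrE // !mulr_ge0 ?sqrtr_ge0 // ltW.
rewrite sgE mulNr lerNl ler_pdivlMr ?mulr_gt0 ?exprn_gt0 //.
move: h; rewrite !exprMn kap2.
have -> : s ^+ 2 * (n.+2%:R ^+ 2 * (- 4 * E / s)) = 4 * (- E * (s * n.+2%:R ^+ 2)).
  by field; apply: lt0r_neq0.
by move=> h; lra.
Qed.

(** Summing the invariant expresses (n + 1) E through X, Y and V_0. Combined with the energy
    identity X + s Y = 2 V_0, it becomes an identity for 2 - (s Y - X) with main term 2 (n + 2) E,
    which [rellich_lower] bounds. The excess over 2 is exactly what the constant mode contributes in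
    [cosmx_row_sum]. *)
Lemma rellich_bound (X Y : R) :
  X = \sum_(i < n.+1) (V i.+1 - V i) ^+ 2 -> Y = \sum_(i < n.+2) V i ^+ 2 ->
  X + s * Y = 2 * V 0 ->
  s * Y - X <= 2 + (1 + sg) ^+ 2 / (n.+2%:R * s).
Proof.
move=> XE YE XY.
have m_gt0 : 0 < n.+2%:R :> R by rewrite ltr0n.
have sumE : (n.+2%:R - 1) * E = (1 + s / 2) * X - s * Y + s * V 0 ^+ 2.
  have -> : (n.+2%:R - 1) * E = \sum_(i < n.+1) E.
    rewrite sumr_const card_ord -[RHS]mulr_natl; congr (_ * _).
    by rewrite -[n.+2%:R]natr1; ring.
  rewrite (eq_bigr (fun i : 'I_n.+1 => (1 + s / 2) * (V i.+1 - V i) ^+ 2 -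
       s / 2 * (V i ^+ 2 + V i.+1 ^+ 2))); last first.
    by move=> i _; rewrite -(@rellich_invariant i) ?leq_ord //; field.
  rewrite sumrB -!mulr_sumr -XE big_split /=.
  have Y1 : Y = \sum_(i < n.+1) V i ^+ 2 + V 0 ^+ 2.
    by rewrite YE big_ord_recr /= Vlast; case: sg1 => ->; rewrite ?mul1r // mulN1r sqrrN.
  have Y2 : Y = V 0 ^+ 2 + \sum_(i < n.+1) V i.+1 ^+ 2.
    by rewrite YE big_ord_recl.
  have -> : \sum_(i < n.+1) V i ^+ 2 = Y - V 0 ^+ 2 by rewrite Y1; ring.
  have -> : \sum_(i < n.+1) V i.+1 ^+ 2 = Y - V 0 ^+ 2 by rewrite Y2; ring.
  by field.
have main : (2 + s / 2) * (2 - (s * Y - X)) =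
    2 * n.+2%:R * E + 2 + s + s * V 0.
  have YE' : s * Y = 2 * V 0 - X by rewrite -XY; ring.
  have : (n.+2%:R - 1) * E = (2 + s / 2) * X - 2 * V 0 + s * V 0 ^+ 2.
    by rewrite sumE YE'; field.
  have -> : 2 * n.+2%:R * E = 2 * ((n.+2%:R - 1) * E) + 2 * E by ring.
  by move=> ->; rewrite YE' /E; field.
have low : - ((1 + sg) ^+ 2 / (n.+2%:R * s)) * 2 <= 2 * n.+2%:R * E.
  have -> : - ((1 + sg) ^+ 2 / (n.+2%:R * s)) * 2 =
     2 * n.+2%:R * (- (1 + sg) ^+ 2 / (s * n.+2%:R ^+ 2)).
    by field; rewrite !lt0r_neq0.
  by rewrite ler_pM2l ?mulr_gt0 //; exact: rellich_lower.
have w0 : 0 <= (1 + sg) ^+ 2 / (n.+2%:R * s).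
  by rewrite divr_ge0 ?sqr_ge0 // mulr_ge0 // ltW.
have sV0 : 0 <= s * V 0 by rewrite mulr_ge0 // ltW.
set w := _ / _ in w0 low *.
rewrite -subr_ge0 -(@pmulr_rge0 _ (2 + s / 2)); last by rewrite addr_gt0 // divr_gt0.
have -> : (2 + s / 2) * (2 + w - (s * Y - X)) = (2 + s / 2) * (2 - (s * Y - X)) + (2 + s / 2) * w.
  by ring.
rewrite main; have sw : 0 <= s / 2 * w by rewrite mulr_ge0 // divr_ge0 // ltW.
clearbody w.
have -> : (2 + s / 2) * w = 2 * w + s / 2 * w by ring.
move: (2 * n.+2%:R * E) (s / 2 * w) (s * V 0) low sw sV0 => e z y low z0 y0.
by have := s_gt0; lra.
Qed.

End RellichIdentity.

(** * The cosine and sine bases *)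

Section CosineBasis.
Context (R : realType) (n : nat).
Local Notation m := n.+2.

Definition cos_arg (j : nat) : R := pi * j%:R / (2 * m%:R).
Definition cos_vec (j i : nat) : R := cos (cos_arg j * (2 * i%:R + 1)).
Definition cos_eig (j : nat) : R := 2 - 2 * cos (2 * cos_arg j).

Lemma cos_arg_m j : cos_arg j * (2 * m%:R) = pi * j%:R.
Proof. by rewrite divfK // mulf_neq0 ?pnatr_eq0. Qed.

Lemma cosDpin (x : R) (j : nat) : cos (x + pi * j%:R) = (-1) ^+ j * cos x.
Proof.
elim: j => [|j IH]; first by rewrite mulr0 addr0 expr0 mul1r.
by rewrite -natr1 mulrDr mulr1 addrA cosDpi IH exprS mulN1r mulNr.
Qed.

Lemma cos_vec_last j : cos_vec j n.+1 = (-1) ^+ j * cos_vec j 0.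
Proof.
rewrite /cos_vec -[in RHS]cosN -cosDpin -cos_arg_m -natr1; congr cos; ring.
Qed.

Lemma cos_vec_over j : cos_vec j n.+2 = cos_vec j n.+1.
Proof.
rewrite cos_vec_last /cos_vec -cosDpin -cos_arg_m; congr cos; ring.
Qed.

Lemma cos_vec_rec (j i : nat) :
  2 * cos_vec j i.+1 - cos_vec j i - cos_vec j i.+2 = cos_eig j * cos_vec j i.+1.
Proof.
rewrite /cos_vec /cos_eig; set p := cos_arg j.
have -> : p * (2 * i.+2%:R + 1) = p * (2 * i.+1%:R + 1) + 2 * p by rewrite -!natr1; ring.
have -> : p * (2 * i%:R + 1) = p * (2 * i.+1%:R + 1) - 2 * p by rewrite -!natr1; ring.
by rewrite cosB cosD; ring.
Qed.

Lemma cos_vec_rec0 (j : nat) :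
  cos_vec j 0 - cos_vec j 1 = cos_eig j * cos_vec j 0.
Proof.
have -> : cos_vec j 0 - cos_vec j 1 =
    2 * cos_vec j 0 - cos (cos_arg j * (2 * 0 + 1) - 2 * cos_arg j) - cos_vec j 1.
  rewrite /cos_vec -[X in 2 * _ - X]cosN.
  have -> : - (cos_arg j * (2 * 0 + 1) - 2 * cos_arg j) = cos_arg j * (2 * 0 + 1) by ring.
  by ring.
rewrite /cos_vec /cos_eig; set p := cos_arg j.
have -> : p * (2 * 1 + 1) = p * (2 * 0 + 1) + 2 * p by ring.
by rewrite cosB cosD; ring.
Qed.

Lemma T_N_cos (j : nat) :
  T_N R m *m (\col_i cos_vec j i) = cos_eig j *: (\col_i cos_vec j i).
Proof.
apply/matrixP => i k; rewrite ord1 (T_N_mul (cos_vec j)) !mxE.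
case: i => -[|i] hi /=; first by rewrite sub0r opprB cos_vec_rec0.
rewrite -cos_vec_rec eqSS; case: eqP => [->|_]; last by ring.
by rewrite cos_vec_over; ring.
Qed.

Lemma cos_arg_itv (j : nat) : (j < m)%N -> 0 <= cos_arg j < pi / 2.
Proof.
move=> jm; rewrite /cos_arg; apply/andP; split.
  by rewrite divr_ge0 ?mulr_ge0 // ?pi_ge0.
rewrite -mulrA ltr_pM2l ?pi_gt0 // invfM mulrCA -[ltRHS]mulr1 ltr_pM2l ?invr_gt0 //.
by rewrite ltr_pdivrMr ?ltr0n // mul1r ltr_nat.
Qed.

Lemma cos_arg2_itv (j : nat) : (j < m)%N -> 2 * cos_arg j \in `[0, pi]%R.
Proof.
by move=> /cos_arg_itv /andP[h0 h1]; rewrite in_itv /=; apply/andP; split; lra.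
Qed.

Lemma cos_vec0_gt0 (j : nat) : (j < m)%N -> 0 < cos_vec j 0.
Proof.
move=> /cos_arg_itv /andP[h0 h1]; rewrite /cos_vec mulr0 add0r mulr1.
by apply: cos_gt0_pihalf; apply/andP; split => //; have := pi_gt0 R; lra.
Qed.

Lemma cos_eig_inj (j k : nat) : (j < m)%N -> (k < m)%N -> cos_eig j = cos_eig k -> j = k.
Proof.
move=> jm km /eqP; rewrite /cos_eig (inj_eq (addrI _)) (inj_eq oppr_inj).
rewrite (inj_eq (mulfI _)) ?pnatr_eq0 // => /eqP.
move=> /(cos_inj (cos_arg2_itv jm) (cos_arg2_itv km)) /mulfI.
rewrite pnatr_eq0 => /(_ isT) h.
have : pi * j%:R = pi * k%:R :> R by rewrite -!cos_arg_m h.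
by move=> /mulfI; rewrite gt_eqF ?pi_gt0 // => /(_ isT) /eqP; rewrite eqr_nat => /eqP.
Qed.

Lemma cos_eig_ge0 j : 0 <= cos_eig j.
Proof. by rewrite /cos_eig; have := cos_le1 (2 * cos_arg j); lra. Qed.

Lemma cos_eig0 : cos_eig 0 = 0.
Proof. by rewrite /cos_eig /cos_arg mulr0 mul0r mulr0 cos0; ring. Qed.

Lemma cos_eig_eq0 (j : 'I_m) : (cos_eig j == 0) = (j == ord0).
Proof.
apply/eqP/eqP => [|->]; last exact: cos_eig0.
by rewrite -cos_eig0 => /cos_eig_inj h; apply: val_inj; apply: h.
Qed.

Lemma cos_vec_0 i : cos_vec 0 i = 1.
Proof. by rewrite /cos_vec /cos_arg mulr0 !mul0r cos0. Qed.

(** These are eigenvectors of the symmetric matrix T_N for distinct eigenvalues. *)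
Lemma cos_vec_orth (j k : 'I_m) : j != k -> \sum_(i < m) cos_vec j i * cos_vec k i = 0.
Proof.
move=> jk; pose v (l : 'I_m) : 'cV[R]_m := \col_i cos_vec l i.
have vv (l l' : 'I_m) : ((v l)^T *m v l') 0 0 = \sum_(i < m) cos_vec l i * cos_vec l' i.
  by rewrite mxE; apply: eq_bigr => i _; rewrite !mxE.
have h1 : (v j)^T *m T_N R m *m v k = cos_eig k *: ((v j)^T *m v k).
  by rewrite -mulmxA T_N_cos scalemxAr.
have h2 : (v j)^T *m T_N R m *m v k = cos_eig j *: ((v j)^T *m v k).
  by rewrite -{1}trmx_T_N -trmx_mul T_N_cos linearZ /= scalemxAl.
rewrite -vv; apply/eqP; have := congr1 (fun M : 'M[R]_1 => M 0 0) (etrans (esym h1) h2).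
rewrite mxE [RHS]mxE => /eqP; rewrite -subr_eq0 -mulrBl mulf_eq0 => /orP[|//].
rewrite subr_eq0 => /eqP/(cos_eig_inj (ltn_ord _) (ltn_ord _)) h.
by move: jk; rewrite -val_eqE /= h eqxx.
Qed.

(* Locked, lest [mxE] unfold it; so is [sinmx] below.                         *)
Definition cosmx : 'M[R]_m :=
  locked (\matrix_(i, j) (cos_vec j i / Num.sqrt (\sum_(l < m) cos_vec j l ^+ 2))).

Lemma cosmxE i j :
  cosmx i j = cos_vec j i / Num.sqrt (\sum_(l < m) cos_vec j l ^+ 2).
Proof. by rewrite /cosmx -lock mxE. Qed.

Lemma cos_vec_norm_gt0 (j : 'I_m) : 0 < \sum_(l < m) cos_vec j l ^+ 2.
Proof.
rewrite (bigD1 ord0) //= ltr_wpDr ?exprn_gt0 ?cos_vec0_gt0 //.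
by apply: sumr_ge0 => i _; exact: sqr_ge0.
Qed.

Lemma cosmx_orth : cosmx^T *m cosmx = 1%:M.
Proof.
apply/matrixP => j k; rewrite !mxE.
under eq_bigr => i _ do rewrite mxE !cosmxE mulrACA.
rewrite -mulr_suml; have [->|jk] := eqVneq j k; last by rewrite cos_vec_orth // mul0r.
rewrite -invfM -expr2 sqr_sqrtr ?ltW ?cos_vec_norm_gt0 //.
by under eq_bigr do rewrite -expr2; rewrite divff // gt_eqF // cos_vec_norm_gt0.
Qed.

Lemma cosmx_orthV : cosmx *m cosmx^T = 1%:M.
Proof. exact: mulmx1C cosmx_orth. Qed.

Lemma T_N_cosmx (j : 'I_m) : T_N R m *m col j cosmx = cos_eig j *: col j cosmx.
Proof.
have -> : col j cosmx = (Num.sqrt (\sum_(l < m) cos_vec j l ^+ 2))^-1 *: (\col_i cos_vec j i).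
  by apply/matrixP => i k; rewrite !mxE cosmxE mulrC.
by rewrite -scalemxAr T_N_cos !scalerA mulrC.
Qed.

Lemma cosmx_last (j : 'I_m) : cosmx ord_max j = (-1) ^+ j * cosmx ord0 j.
Proof. by rewrite !cosmxE cos_vec_last mulrA. Qed.

Lemma T_N_cosmx_diag : T_N R m *m cosmx = cosmx *m diag_mx (\row_j cos_eig j).
Proof.
apply/matrixP => i j; rewrite mul_mx_diag.
have /matrixP/(_ i 0) := T_N_cosmx j; rewrite {1}colE mulmxA -colE mxE => ->.
by rewrite mxE [RHS]mxE mulrC; congr (_ * _); rewrite mxE.
Qed.

Lemma cosmx_const (i : 'I_m) : cosmx i ord0 = cosmx ord0 ord0.
Proof. by rewrite !cosmxE !cos_vec_0. Qed.

Lemma cosmx00_sqr : cosmx ord0 ord0 ^+ 2 = (m%:R)^-1.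
Proof.
have /matrixP/(_ ord0 ord0) := cosmx_orth; rewrite !mxE eqxx.
under eq_bigr => i _ do rewrite mxE cosmx_const -expr2.
rewrite sumr_const card_ord => h.
have m0 : m%:R != 0 :> R by rewrite pnatr_eq0.
by apply: (mulfI m0); rewrite divff // mulr_natl h.
Qed.

(* Apply [rellich_bound] to v = (T_N + s)^-1 (e_first + sg e_last), whose      *)
(* coefficients in the cosine basis are g.                                    *)
Lemma cosmx_row_sum (s : R) (b : bool) : 0 < s ->
  \sum_(j < m | (odd j == b) && (0 < cos_eig j))
     4 * cosmx ord0 j ^+ 2 * (s - cos_eig j) / (s + cos_eig j) ^+ 2 <= 2.
Proof.
move=> s0; pose sg : R := (-1) ^+ b; pose q (j : 'I_m) : R := cosmx ord0 j.
pose f (j : 'I_m) : R := (1 + sg * (-1) ^+ j) * q j.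
pose g (j : 'I_m) : R := f j / (s + cos_eig j).
have st0 (j : nat) : 0 < s + cos_eig j by rewrite ltr_wpDr ?cos_eig_ge0.
have [v vE] : exists v : 'cV[R]_m, v = cosmx *m \col_j g j by eexists.
pose V i : R := v (inord i) 0.
have vV : v = \col_(i < m) V i.
  by apply/matrixP => i k; rewrite ord1 mxE /V inord_val.
have sgE : sg = 1 \/ sg = -1 by rewrite /sg; case: (b); [right|left].
have sgj (j : nat) : sg * (-1) ^+ j = (-1) ^+ (odd j (+) b).
  by rewrite -signr_odd signr_addb mulrC.
have f2 j : 2 * q j * f j = f j ^+ 2.
  by rewrite /f sgj; case: (_ (+) _); rewrite /= ?expr0 ?expr1; ring.
have fsg (j : 'I_m) : (-1) ^+ j * f j = sg * f j.
  have ss : sg * sg = 1 by case: sgE => ->; ring.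
  have jj : (-1) ^+ j * (-1) ^+ j = 1 :> R by rewrite -expr2 sqrr_sign.
  rewrite /f; transitivity (((-1) ^+ j + sg * ((-1) ^+ j * (-1) ^+ j)) * q j); first by ring.
  transitivity ((sg + (sg * sg) * (-1) ^+ j) * q j); last by ring.
  by rewrite ss jj; ring.
have V0E : V 0 = \sum_j q j * g j.
  rewrite /V vE (_ : inord 0 = ord0) ?mxE; last by apply: val_inj; rewrite /= inordK.
  by apply: eq_bigr => j _; rewrite mxE.
have V0E2 : 2 * V 0 = \sum_j f j * g j.
  rewrite V0E mulr_sumr; apply: eq_bigr => j _.
  transitivity ((2 * q j * f j) / (s + cos_eig j)); first by rewrite /g; ring.
  by rewrite f2 /g; ring.
have Vl : V n.+1 = sg * V 0.
  rewrite V0E /V vE (_ : inord n.+1 = ord_max) ?mxE; last by apply: val_inj; rewrite /= inordK.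
  rewrite mulr_sumr; apply: eq_bigr => j _; rewrite !mxE cosmx_last -/(q j) /g.
  transitivity ((-1) ^+ j * f j * (q j / (s + cos_eig j))); first by ring.
  by rewrite fsg; ring.
have eqn : T_N R m *m v + s *: v = \col_i ((i == ord0)%:R + sg * (i == ord_max)%:R).
  rewrite vE mulmxA T_N_cosmx_diag -mulmxA scalemxAr -mulmxDr.
  have -> : diag_mx (\row_j cos_eig j) *m (\col_j g j) + s *: (\col_j g j) = \col_j f j.
    apply/matrixP => j k; rewrite mul_diag_mx !mxE /g.
    by field; rewrite lt0r_neq0 // addrC.
  apply/matrixP => i k; rewrite !mxE.
  under eq_bigr => j _ do rewrite mxE /f mulrDl mul1r mulrDr.
  rewrite big_split /=; congr (_ + _).
    have /matrixP/(_ i ord0) := cosmx_orthV; rewrite !mxE => <-.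
    by apply: eq_bigr => j _; rewrite mxE.
  have /matrixP/(_ i ord_max) := cosmx_orthV; rewrite !mxE => <-.
  rewrite mulr_sumr; apply: eq_bigr => j _; rewrite [in RHS]mxE cosmx_last /q; ring.
have row (i : 'I_m) := congr1 (fun M : 'cV[R]_m => M i 0) eqn.
have {}row (i : 'I_m) : (if i == 0%N :> nat then 0 else V i - V i.-1) -
   (if i == n.+1 :> nat then 0 else V i.+1 - V i) + s * V i =
   (i == ord0)%:R + sg * (i == ord_max)%:R.
  by have := row i; rewrite vV mxE T_N_mul !mxE.
have r0 : V 0 - V 1 + s * V 0 = 1.
  by have := row ord0; rewrite /= mulr0 addr0 sub0r opprB.
have rS i : (i < n)%N -> 2 * V i.+1 - V i - V i.+2 + s * V i.+1 = 0.
  move=> hi; have hi2 : (i.+1 < m)%N by rewrite ltnW // !ltnS.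
  have := row (Ordinal hi2); rewrite -!val_eqE /= eqSS ltn_eqF // !mulr0n mulr0 addr0 => <-.
  by ring.
have rl : V n.+1 - V n + s * V n.+1 = sg.
  by have := row ord_max; rewrite -!val_eqE /= eqxx mulr1 add0r subr0.
have normv : \sum_(i < m) V i ^+ 2 = \sum_j g j ^+ 2.
  transitivity ((v^T *m v) 0 0).
    by rewrite mxE; apply: eq_bigr => i _; rewrite mxE vV mxE expr2.
  rewrite vE trmx_mul mulmxA -(mulmxA _ cosmx^T) cosmx_orth mulmx1 mxE.
  by apply: eq_bigr => j _; rewrite !mxE expr2.
have normT : \sum_(i < n.+1) (V i.+1 - V i) ^+ 2 = \sum_(j < m) cos_eig j * g j ^+ 2.
  transitivity (((( B_D R m)^T *m v)^T *m ((B_D R m)^T *m v)) 0 0).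
    by rewrite mxE; apply: eq_bigr => i _; rewrite mxE vV trB_D_mul expr2.
  rewrite trmx_mul trmxK -mulmxA (mulmxA (B_D R m)) -/(T_N R m).
  rewrite vE (mulmxA (T_N R m)) T_N_cosmx_diag.
  rewrite trmx_mul !mulmxA -(mulmxA _ cosmx^T) cosmx_orth mulmx1 -mulmxA mxE.
  by apply: eq_bigr => j _; rewrite mul_diag_mx !mxE; ring.
have := @rellich_bound R n s sg V s0 sgE _ r0 rS rl Vl _ _ (esym normT) (esym normv).
have V0_ge0 : 0 <= V 0.
  suff : 0 <= 2 * V 0 by lra.
  rewrite V0E2; apply: sumr_ge0 => j _; rewrite /g mulrA divr_ge0 ?(ltW (st0 _)) //.
  by rewrite -expr2 sqr_ge0.
move=> /(_ V0_ge0); set Z := s * _ - _ => bound.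
have Z0 : Z = \sum_j f j ^+ 2 * (s - cos_eig j) / (s + cos_eig j) ^+ 2.
  rewrite /Z mulr_sumr -sumrB; apply: eq_bigr => j _; rewrite /g.
  by field; rewrite lt0r_neq0.
have {}bound : Z <= 2 + (1 + sg) ^+ 2 / (m%:R * s).
  apply: bound; rewrite V0E2 mulr_sumr -big_split; apply: eq_bigr => j _ /=.
  by rewrite /g; field; rewrite lt0r_neq0.
rewrite (eq_bigl (fun j : 'I_m => (odd j == b) && (j != ord0))); last first.
  by move=> j; rewrite lt0r cos_eig_ge0 andbT cos_eig_eq0.
have -> : \sum_(j < m | (odd j == b) && (j != ord0))
     4 * cosmx ord0 j ^+ 2 * (s - cos_eig j) / (s + cos_eig j) ^+ 2 =
   \sum_(j < m | j != ord0) f j ^+ 2 * (s - cos_eig j) / (s + cos_eig j) ^+ 2.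
  rewrite big_andbC big_mkcondr; apply: eq_bigr => j _.
  rewrite /f sgj; case: (odd j) (b) => -[] /=; rewrite -/(q j) ?expr0 ?expr1.
  - by congr (_ * _ / _); ring.
  - by rewrite subrr mul0r expr0n /= !mul0r.
  - by rewrite subrr mul0r expr0n /= !mul0r.
  - by congr (_ * _ / _); ring.
(* The mode 0, absent from the claimed sum, cancels the excess term of [rellich_bound]. *)
move: bound; rewrite Z0 (bigD1 ord0) //= cos_eig0 subr0 addr0.
have -> : f ord0 ^+ 2 * s / s ^+ 2 = (1 + sg) ^+ 2 / (m%:R * s).
  rewrite /f expr0 mulr1 exprMn /q cosmx00_sqr.
  have : m%:R != 0 :> R by rewrite pnatr_eq0.
  by move: (m%:R : R) => M M0; field; rewrite M0 lt0r_neq0.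
by rewrite addrC lerD2r.
Qed.

Lemma cosmx_rowE (i k : 'I_m) : \sum_j cosmx i j * cosmx k j = (i == k)%:R.
Proof.
have /matrixP/(_ i k) := cosmx_orthV; rewrite !mxE => <-.
by apply: eq_bigr => j _; rewrite mxE.
Qed.

Lemma cosmx_colE (j k : 'I_m) : \sum_i cosmx i j * cosmx i k = (j == k)%:R.
Proof.
have /matrixP/(_ j k) := cosmx_orth; rewrite !mxE => <-.
by apply: eq_bigr => i _; rewrite mxE.
Qed.

(** This and the next two identities are what [boundary_form_half] asks of the basis. They come from
    the unit norm of the first row, its orthogonality to the last row, and the corner entry 1 of
    T_N. *)
Lemma cosmx_sqr_sum : \sum_j cosmx ord0 j ^+ 2 = 1.
Proof. by under eq_bigr do rewrite expr2; rewrite cosmx_rowE eqxx. Qed.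

Lemma cosmx_alt_sum : \sum_(j < m) (-1) ^+ odd j * cosmx ord0 j ^+ 2 = 0.
Proof.
rewrite -[RHS](cosmx_rowE ord_max ord0); apply: eq_bigr => j _.
by rewrite cosmx_last signr_odd expr2 mulrA.
Qed.

Lemma cosmx_eig_sum : \sum_(j < m) cos_eig j * cosmx ord0 j ^+ 2 = 1.
Proof.
have : (T_N R m *m cosmx *m cosmx^T) ord0 ord0 = 1.
  rewrite -mulmxA cosmx_orthV mulmx1.
  have := T_N_mul (fun i => (i == 0%N)%:R : R) (@ord0 n.+1).
  rewrite mxE (bigD1 ord0) //= mxE eqxx mulr1 big1 => [|j j0]; last first.
    by rewrite mxE; move: j0; rewrite -val_eqE /= => /negPf ->; rewrite mulr0.
  by rewrite addr0 => ->; ring.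
rewrite T_N_cosmx_diag mul_mx_diag mxE => <-.
by apply: eq_bigr => j _; rewrite !mxE; ring.
Qed.

Lemma cosmx_sum (j : 'I_m) : j != ord0 -> \sum_i cosmx i j = 0.
Proof.
move=> j0; have q0 : cosmx ord0 ord0 != 0.
  by rewrite -sqrf_eq0 cosmx00_sqr invr_eq0 pnatr_eq0.
apply: (mulfI q0); rewrite mulr0 mulr_sumr.
under eq_bigr => i _ do rewrite -(cosmx_const i).
by rewrite cosmx_colE eq_sym (negPf j0).
Qed.

(* Column 0 is zero (the eigenvalue is 0 and 0^-1 = 0); the other columns are *)
(* an orthonormal eigenbasis of T_D.                                          *)
Definition sinmx : 'M[R]_(m.-1, m) :=
  locked ((B_D R m)^T *m cosmx *m diag_mx (\row_j (Num.sqrt (cos_eig j))^-1)).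

Lemma sinmxE : sinmx = (B_D R m)^T *m cosmx *m diag_mx (\row_j (Num.sqrt (cos_eig j))^-1).
Proof. by rewrite /sinmx -lock. Qed.

(** Together with [B_D_sinmx], this is the singular value decomposition of [B_D]; it makes
    divergence and gradient diagonal in the Fourier modes. *)
Lemma trB_D_cosmx : (B_D R m)^T *m cosmx = sinmx *m diag_mx (\row_j Num.sqrt (cos_eig j)).
Proof.
rewrite sinmxE -!mulmxA mulmx_diag mulmxA; apply/matrixP => i j.
rewrite mul_mx_diag [RHS]mxE.
have [->|j0] := eqVneq j ord0; last first.
  by rewrite !mxE mulVf ?mulr1 // sqrtr_eq0 -ltNge lt0r cos_eig_eq0 j0 cos_eig_ge0.
rewrite (_ : (_ *m _) i ord0 = 0) ?mul0r //.
have := trB_D_mul (fun _ => cosmx ord0 ord0) i; rewrite subrr => <-.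
by rewrite !mxE; apply: eq_bigr => k _; congr (_ * _); rewrite mxE cosmx_const.
Qed.

Lemma B_D_sinmx : B_D R m *m sinmx = cosmx *m diag_mx (\row_j Num.sqrt (cos_eig j)).
Proof.
rewrite sinmxE !mulmxA -/(T_N R m) T_N_cosmx_diag -mulmxA mulmx_diag.
congr (_ *m diag_mx _); apply/rowP => j; rewrite !mxE.
have [j0|j0] := eqVneq (cos_eig j) 0; first by rewrite j0 sqrtr0 mul0r.
by rewrite -{1}(sqr_sqrtr (cos_eig_ge0 j)) expr2 mulfK // sqrtr_eq0 -ltNge lt0r j0 cos_eig_ge0.
Qed.

Lemma T_D_sinmx : T_D R m *m sinmx = sinmx *m diag_mx (\row_j cos_eig j).
Proof.
rewrite /T_D -mulmxA B_D_sinmx mulmxA trB_D_cosmx -mulmxA mulmx_diag.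
congr (_ *m diag_mx _); apply/rowP => j.
by rewrite !mxE -expr2 sqr_sqrtr ?cos_eig_ge0.
Qed.

Lemma sinmx_orth : sinmx^T *m sinmx = diag_mx (\row_(j < m) (j != ord0)%:R).
Proof.
rewrite {2}sinmxE mulmxA mulmxA -trmx_mul B_D_sinmx trmx_mul tr_diag_mx.
rewrite -(mulmxA _ cosmx^T) cosmx_orth mulmx1 mulmx_diag; congr diag_mx.
apply/rowP => j; rewrite !mxE -cos_eig_eq0.
have [->|j0] := eqVneq (cos_eig j) 0; first by rewrite sqrtr0 mul0r.
by rewrite divff // sqrtr_eq0 -ltNge lt0r j0 cos_eig_ge0.
Qed.

Lemma sinmx_ord0 i : sinmx i ord0 = 0.
Proof. by rewrite sinmxE mul_mx_diag mxE [X in _ * X]mxE cos_eig0 sqrtr0 invr0 mulr0. Qed.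

(** Without its zero column the matrix is square with orthonormal columns, hence orthogonal, and the
    zero column adds nothing to the product. *)
Lemma sinmx_orthV : sinmx *m sinmx^T = 1%:M.
Proof.
pose S : 'M[R]_n.+1 := \matrix_(i, j) sinmx i (lift ord0 j).
have SS : S^T *m S = 1%:M.
  apply/matrixP => j k; rewrite mxE [RHS]mxE.
  transitivity ((sinmx^T *m sinmx) (lift ord0 j) (lift ord0 k)).
    by rewrite mxE; apply: eq_bigr => i _; rewrite !mxE.
  by rewrite sinmx_orth mxE [X in X *+ _]mxE (inj_eq lift_inj).
rewrite -(mulmx1C SS); apply/matrixP => i k; rewrite mxE [RHS]mxE big_ord_recl.
rewrite sinmx_ord0 mul0r add0r; apply: eq_bigr => j _.
by rewrite !mxE.
Qed.

End CosineBasis.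

(** * Kronecker products acting on vectors, and a dual form of the inf-sup condition *)

Lemma big_mxtens_index (R : nmodType) m n (f : 'I_(m * n) -> R) :
  \sum_k f k = \sum_i \sum_j f (mxtens_index (i, j)).
Proof.
rewrite pair_big /= (reindex (@mxtens_index m n)).
  by apply: eq_bigr => -[i j].
by exists (@mxtens_unindex m n) => x _; [exact: mxtens_indexK | exact: mxtens_unindexK].
Qed.

Lemma tensmx_mul_col (R : comPzRingType) m n p q (A : 'M[R]_(m, n)) (B : 'M[R]_(p, q))
    (v : 'cV[R]_(n * q)) i j :
  ((A *t B) *m v) (mxtens_index (i, j)) 0 =
  \sum_k A i k * \sum_l B j l * v (mxtens_index (k, l)) 0.
Proof.
rewrite mxE big_mxtens_index; apply: eq_bigr => k _.
by rewrite mulr_sumr; apply: eq_bigr => l _; rewrite tensmxE mulrA.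
Qed.

Lemma sum_delta_l (R : pzRingType) (I : finType) (i : I) (f : I -> R) :
  \sum_k (i == k)%:R * f k = f i.
Proof.
rewrite (bigD1 i) //= eqxx mul1r big1 ?addr0 // => k ki.
by rewrite eq_sym (negPf ki) mul0r.
Qed.

Lemma tensmx1_mul_col (R : comPzRingType) m n q (A : 'M[R]_(m, n))
    (v : 'cV[R]_(n * q)) i j :
  ((A *t (1%:M : 'M_q)) *m v) (mxtens_index (i, j)) 0 =
  \sum_k A i k * v (mxtens_index (k, j)) 0.
Proof.
rewrite tensmx_mul_col; apply: eq_bigr => k _; congr (_ * _).
by under eq_bigr do rewrite mxE; rewrite sum_delta_l.
Qed.

Lemma tens1mx_mul_col (R : comPzRingType) m p q (B : 'M[R]_(p, q))
    (v : 'cV[R]_(m * q)) i j :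
  (((1%:M : 'M_m) *t B) *m v) (mxtens_index (i, j)) 0 =
  \sum_k B j k * v (mxtens_index (i, k)) 0.
Proof.
rewrite tensmx_mul_col.
by under eq_bigr do rewrite mxE; rewrite sum_delta_l.
Qed.

Lemma tensmx11 (R : comPzRingType) m n : (1%:M : 'M[R]_m) *t (1%:M : 'M[R]_n) = 1%:M.
Proof.
apply/matrixP => k l; case: (mxtens_indexP k) => i j; case: (mxtens_indexP l) => i' j'.
rewrite tensmxE !mxE (can_eq (@mxtens_indexK m n)) xpair_eqE.
by case: (i == i'); case: (j == j'); rewrite ?mulr1 ?mulr0 ?mul0r.
Qed.

Definition dotc (R : pzSemiRingType) n (u v : 'cV[R]_n) : R := (u^T *m v) 0 0.

Lemma dotcE (R : pzSemiRingType) n (u v : 'cV[R]_n) : dotc u v = \sum_i u i 0 * v i 0.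
Proof. by rewrite /dotc mxE; apply: eq_bigr => i _; rewrite mxE. Qed.

(* Over all multiples of a given u, the best of the inequalities              *)
(* 2 (Gs u, p) <= (N u, u) + M is (Gs u, p)^2 <= M (N u, u).                  *)
Definition discrete_inf_sup (R : realType) (nx ny : nat) (lam : R) :=
  forall p M, p \in pressure R nx ny ->
  (forall u, 2 * dotc (Gstar_mx nx ny 1 *m u) p <= dotc u (negL_mx nx ny 1 *m u) + M) ->
  lam * dotc p p <= M.

(** * The discretization in Fourier modes, for h = 1 *)

Section Fourier.
Context (R : realType) (n1 n2 : nat).
Local Notation nx := n1.+2.
Local Notation ny := n2.+2.
Local Notation Cx := (cosmx R n1).
Local Notation Cy := (cosmx R n2).
Local Notation Sx := (sinmx R n1).
Local Notation Sy := (sinmx R n2).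

Definition mode_u : 'M[R]_(ny * nx.-1, ny * nx) := Cy *t Sx.
Definition mode_v : 'M[R]_(ny.-1 * nx, ny * nx) := Sy *t Cx.
Definition mode_p : 'M[R]_(ny * nx) := Cy *t Cx.

Definition cu (u : velocity R nx ny) (i : 'I_nx) (j : 'I_ny) : R :=
  (mode_u^T *m usubmx u) (mxtens_index (j, i)) 0.
Definition cv (u : velocity R nx ny) (i : 'I_nx) (j : 'I_ny) : R :=
  (mode_v^T *m dsubmx u) (mxtens_index (j, i)) 0.
Definition cp (p : 'cV[R]_(ny * nx)) (i : 'I_nx) (j : 'I_ny) : R :=
  (mode_p^T *m p) (mxtens_index (j, i)) 0.

Definition sx (i : 'I_nx) : R := cos_eig R n1 i.
Definition ty (j : 'I_ny) : R := cos_eig R n2 j.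

Lemma mode_u_orthV : mode_u *m mode_u^T = 1%:M.
Proof. by rewrite trmx_tens tensmx_mul cosmx_orthV sinmx_orthV tensmx11. Qed.

Lemma mode_v_orthV : mode_v *m mode_v^T = 1%:M.
Proof. by rewrite trmx_tens tensmx_mul cosmx_orthV sinmx_orthV tensmx11. Qed.

Lemma mode_p_orthV : mode_p *m mode_p^T = 1%:M.
Proof. by rewrite trmx_tens tensmx_mul !cosmx_orthV tensmx11. Qed.

Lemma parseval m n (M : 'M[R]_(m, n)) (u v : 'cV[R]_m) : M *m M^T = 1%:M ->
  dotc (M^T *m u) (M^T *m v) = dotc u v.
Proof. by move=> MM; rewrite /dotc trmx_mul trmxK mulmxA -(mulmxA _ M) MM mulmx1. Qed.

Lemma dotc_cp p q : dotc p q = \sum_i \sum_j cp p i j * cp q i j.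
Proof.
by rewrite -(parseval _ _ mode_p_orthV) dotcE big_mxtens_index exchange_big.
Qed.

Lemma dotc_split (u v : velocity R nx ny) :
  dotc u v = dotc (usubmx u) (usubmx v) + dotc (dsubmx u) (dsubmx v).
Proof.
rewrite !dotcE big_split_ord /=; congr (_ + _); apply: eq_bigr => i _;
by rewrite !mxE.
Qed.

Lemma dotc_cuv u v :
  dotc u v = \sum_i \sum_j (cu u i j * cu v i j + cv u i j * cv v i j).
Proof.
rewrite dotc_split -(parseval _ _ mode_u_orthV) -(parseval _ _ mode_v_orthV).
rewrite !dotcE !big_mxtens_index -big_split exchange_big.
rewrite exchange_big /= [RHS]exchange_big; apply: eq_bigr => j _.
by rewrite -big_split.
Qed.

Lemma diag_mx_sum (F : pzRingType) m (d : 'rV[F]_m) (i : 'I_m) (f : 'I_m -> F) :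
  \sum_k diag_mx d i k * f k = d 0 i * f i.
Proof.
under eq_bigr => k _ do rewrite mxE -mulr_natl -mulrA.
by rewrite sum_delta_l.
Qed.

Lemma Gstar_mx1 (F : fieldType) (h : F) mx my :
  Gstar_mx mx my h = h^-1 *: Gstar_mx mx my 1.
Proof. by rewrite /Gstar_mx invr1 scale1r. Qed.

Lemma negL_mx1 (F : fieldType) (h : F) mx my :
  negL_mx mx my h = h ^- 2 *: negL_mx mx my 1.
Proof. by rewrite /negL_mx expr1n invr1 scale1r. Qed.

Lemma cp_Gstar u i j :
  cp (Gstar_mx nx ny 1 *m u) i j =
  Num.sqrt (sx i) * cu u i j + Num.sqrt (ty j) * cv u i j.
Proof.
rewrite /cp /Gstar_mx invr1 scale1r -[in LHS](vsubmxK u) mul_row_col mulmxDr mxE.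
rewrite !mulmxA /mode_p trmx_tens !tensmx_mul !mulmx1.
have trB m : (cosmx R m)^T *m B_D R m.+2 =
    diag_mx (\row_j Num.sqrt (cos_eig R m j)) *m (sinmx R m)^T.
  by rewrite -[B_D _ _]trmxK -trmx_mul trB_D_cosmx trmx_mul tr_diag_mx.
rewrite !trB; congr (_ + _).
  rewrite -[Cy^T]mul1mx -tensmx_mul -mulmxA tens1mx_mul_col diag_mx_sum mxE.
  by rewrite /cu trmx_tens.
rewrite -[Cx^T]mul1mx -tensmx_mul -mulmxA tensmx1_mul_col diag_mx_sum mxE.
by rewrite /cv trmx_tens.
Qed.

Lemma trBS m : (sinmx R m)^T *m (B_D R m.+2)^T =
    diag_mx (\row_j Num.sqrt (cos_eig R m j)) *m (cosmx R m)^T.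
Proof. by rewrite -trmx_mul B_D_sinmx trmx_mul tr_diag_mx. Qed.

Lemma trGstar1 : (Gstar_mx nx ny 1 : 'M[R]_(_, _))^T =
   col_mx ((1%:M : 'M_ny) *t (B_D R nx)^T) ((B_D R ny)^T *t (1%:M : 'M_nx)).
Proof. by rewrite /Gstar_mx invr1 scale1r tr_row_mx !trmx_tens !trmx1. Qed.

Lemma cu_trGstar p i j :
  cu ((Gstar_mx nx ny 1)^T *m p) i j = Num.sqrt (sx i) * cp p i j.
Proof.
rewrite /cu trGstar1 mul_col_mx col_mxKu mulmxA /mode_u trmx_tens tensmx_mul mulmx1 trBS.
rewrite -[Cy^T]mul1mx -tensmx_mul -mulmxA tens1mx_mul_col diag_mx_sum mxE.
by rewrite /cp trmx_tens.
Qed.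

Lemma cv_trGstar p i j :
  cv ((Gstar_mx nx ny 1)^T *m p) i j = Num.sqrt (ty j) * cp p i j.
Proof.
rewrite /cv trGstar1 mul_col_mx col_mxKd mulmxA /mode_v trmx_tens tensmx_mul mulmx1 trBS.
rewrite -[Cx^T]mul1mx -tensmx_mul -mulmxA tensmx1_mul_col diag_mx_sum mxE.
by rewrite /cp trmx_tens.
Qed.

(** * Tangential traces and the velocity Laplacian in Fourier modes *)

Definition end_row m (l : bool) : 'I_m.+2 := if l then ord_max else ord0.

(* l = false and l = true stand for the first and the last row (resp. column) *)
(* of cells, the index i (resp. j) for the sine coefficient along it.         *)
Definition trace_u (u : velocity R nx ny) (l : bool) (i : 'I_nx) : R :=
  (((1%:M : 'M_ny) *t Sx^T) *m usubmx u) (mxtens_index (end_row n2 l, i)) 0.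
Definition trace_v (u : velocity R nx ny) (l : bool) (j : 'I_ny) : R :=
  ((Sy^T *t (1%:M : 'M_nx)) *m dsubmx u) (mxtens_index (j, end_row n1 l)) 0.

Lemma sum_ends m (f : 'I_m.+2 -> R) :
  \sum_k ((k == ord0) || (k == ord_max))%:R * f k = \sum_(l : bool) f (end_row m l).
Proof.
rewrite (bigD1 ord0) //= (bigD1 ord_max) //= big1 => [|k /andP[k0 km]].
  by rewrite big_bool /= ?eqxx ?orbT !mul1r addr0 addrC.
by rewrite (negPf k0) (negPf km) mul0r.
Qed.

Lemma cuE u i j : cu u i j = \sum_k Cy k j *
   (((1%:M : 'M_ny) *t Sx^T) *m usubmx u) (mxtens_index (k, i)) 0.
Proof.
rewrite /cu /mode_u trmx_tens -[Cy^T]mulmx1 -[Sx^T]mul1mx -tensmx_mul -mulmxA.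
by rewrite tensmx1_mul_col ?mulmx1 ?mul1mx; apply: eq_bigr => k _; rewrite mxE.
Qed.

Lemma cvE u i j : cv u i j = \sum_k Cx k i *
   ((Sy^T *t (1%:M : 'M_nx)) *m dsubmx u) (mxtens_index (j, k)) 0.
Proof.
rewrite /cv /mode_v trmx_tens -[Cx^T]mulmx1 -[Sy^T]mul1mx -tensmx_mul -mulmxA.
by rewrite tens1mx_mul_col ?mulmx1 ?mul1mx; apply: eq_bigr => k _; rewrite mxE.
Qed.

Lemma trace_uE u l i : trace_u u l i = \sum_j Cy (end_row n2 l) j * cu u i j.
Proof.
under eq_bigr => j _ do rewrite cuE mulr_sumr.
rewrite exchange_big /= -[LHS](sum_delta_l (end_row n2 l)
  (fun k => (((1%:M : 'M_ny) *t Sx^T) *m usubmx u) (mxtens_index (k, i)) 0)).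
apply: eq_bigr => k _; under eq_bigr do rewrite mulrA.
by rewrite -mulr_suml cosmx_rowE.
Qed.

Lemma trace_vE u l j : trace_v u l j = \sum_i Cx (end_row n1 l) i * cv u i j.
Proof.
under eq_bigr => i _ do rewrite cvE mulr_sumr.
rewrite exchange_big /= -[LHS](sum_delta_l (end_row n1 l)
  (fun k => ((Sy^T *t (1%:M : 'M_nx)) *m dsubmx u) (mxtens_index (j, k)) 0)).
apply: eq_bigr => k _; under eq_bigr do rewrite mulrA.
by rewrite -mulr_suml cosmx_rowE.
Qed.

Lemma cos_T_E m (j k : 'I_m.+2) : ((cosmx R m)^T *m T_E R m.+2) j k =
  cos_eig R m j * cosmx R m k j +
  2 * (((k == ord0) || (k == ord_max))%:R * cosmx R m k j).
Proof.
have h : (cosmx R m)^T *m T_N R m.+2 =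
    diag_mx (\row_j cos_eig R m j) *m (cosmx R m)^T.
  by rewrite -[T_N _ _](trmx_T_N) -trmx_mul T_N_cosmx_diag trmx_mul tr_diag_mx.
rewrite /T_E mulmxDr h -scalemxAr /E_0 mul_mx_diag mul_diag_mx !mxE -!val_eqE /=.
by congr (_ + _); congr (_ * _); rewrite mulrC.
Qed.

Lemma sin_T_D m : (sinmx R m)^T *m T_D R m.+2 =
  diag_mx (\row_j cos_eig R m j) *m (sinmx R m)^T.
Proof.
have -> : T_D R m.+2 = (T_D R m.+2)^T by rewrite /T_D trmx_mul trmxK.
by rewrite -trmx_mul T_D_sinmx trmx_mul tr_diag_mx.
Qed.

(** The part T_N of T_E is diagonal in these modes. The part 2 E_0 only sees the two extreme rows,
    so it couples the modes through two traces per sine index. *)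
Lemma cu_negL u i j : cu (negL_mx nx ny 1 *m u) i j =
  (sx i + ty j) * cu u i j + 2 * \sum_l Cy (end_row n2 l) j * trace_u u l i.
Proof.
rewrite [in LHS]/cu /negL_mx expr1n invr1 scale1r -[in LHS](vsubmxK u) mul_block_col.
rewrite !mul0mx col_mxKu addr0 mulmxA mulmxDr mulmxDl mxE.
rewrite /mode_u trmx_tens !tensmx_mul !mulmx1 sin_T_D.
rewrite -[X in X *t (diag_mx _ *m _)]mul1mx -tensmx_mul -mulmxA tens1mx_mul_col.
rewrite diag_mx_sum mxE [(sx i + _) * _]mulrDl -addrA; congr (_ + _).
  by rewrite /cu /mode_u trmx_tens.
rewrite -[X in X *t Sx^T]mulmx1 -[Sx^T in X in X = _]mul1mx -tensmx_mul -mulmxA tensmx1_mul_col.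
rewrite cuE mulr_sumr.
under eq_bigr => k _ do rewrite cos_T_E mulrDl -!mulrA.
rewrite big_split /=; congr (_ + _); rewrite -mulr_sumr; congr (_ * _).
by rewrite (sum_ends (fun k => Cy k j * _ (mxtens_index (k, i)) 0)).
Qed.

Lemma cv_negL u i j : cv (negL_mx nx ny 1 *m u) i j =
  (sx i + ty j) * cv u i j + 2 * \sum_l Cx (end_row n1 l) i * trace_v u l j.
Proof.
rewrite [in LHS]/cv /negL_mx expr1n invr1 scale1r -[in LHS](vsubmxK u) mul_block_col.
rewrite !mul0mx col_mxKd add0r mulmxA mulmxDr mulmxDl mxE addrC.
rewrite /mode_v trmx_tens !tensmx_mul !mulmx1 sin_T_D.
rewrite -[X in (diag_mx _ *m _) *t X]mul1mx -tensmx_mul -mulmxA tensmx1_mul_col.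
rewrite diag_mx_sum mxE [(sx i + _) * _]mulrDl (addrC (sx i * _)) -addrA; congr (_ + _).
  by rewrite /cv /mode_v trmx_tens.
rewrite -[X in Sy^T *t X]mulmx1 -[Sy^T in X in X = _]mul1mx.
rewrite -tensmx_mul -mulmxA tens1mx_mul_col.
rewrite cvE mulr_sumr.
under eq_bigr => k _ do rewrite cos_T_E mulrDl -!mulrA.
rewrite big_split /=; congr (_ + _); rewrite -mulr_sumr; congr (_ * _).
by rewrite (sum_ends (fun k => Cx k i * _ (mxtens_index (j, k)) 0)).
Qed.

Lemma dotc_negL u :
  dotc u (negL_mx nx ny 1 *m u) =
  \sum_i \sum_j (sx i + ty j) * (cu u i j ^+ 2 + cv u i j ^+ 2) +
  2 * (\sum_i \sum_l trace_u u l i ^+ 2 + \sum_j \sum_l trace_v u l j ^+ 2).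
Proof.
have hu : \sum_i \sum_l trace_u u l i ^+ 2 =
    \sum_i \sum_j cu u i j * \sum_l Cy (end_row n2 l) j * trace_u u l i.
  apply: eq_bigr => i _; under [RHS]eq_bigr => j _ do rewrite mulr_sumr.
  rewrite exchange_big /=; apply: eq_bigr => l _.
  by rewrite expr2 {1}trace_uE mulr_suml; apply: eq_bigr => j _; ring.
have hv : \sum_j \sum_l trace_v u l j ^+ 2 =
    \sum_i \sum_j cv u i j * \sum_l Cx (end_row n1 l) i * trace_v u l j.
  rewrite [RHS]exchange_big; apply: eq_bigr => j _ /=.
  under [RHS]eq_bigr => i _ do rewrite mulr_sumr.
  rewrite exchange_big /=; apply: eq_bigr => l _.
  by rewrite expr2 {1}trace_vE mulr_suml; apply: eq_bigr => i _; ring.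
rewrite hu hv -big_split mulr_sumr -big_split dotc_cuv; apply: eq_bigr => i _ /=.
rewrite -big_split mulr_sumr -big_split; apply: eq_bigr => j _ /=.
by rewrite cu_negL cv_negL; ring.
Qed.

(** Column 0 of [sinmx] is zero: the coefficient is a dummy that lets velocities and pressures share
    one index set. *)
Lemma cu_ord0 u j : cu u ord0 j = 0.
Proof.
rewrite cuE big1 // => k _; rewrite tens1mx_mul_col big1 ?mulr0 // => l _.
by rewrite mxE sinmx_ord0 mul0r.
Qed.

Lemma cv_ord0 u i : cv u i ord0 = 0.
Proof.
rewrite cvE big1 // => k _; rewrite tensmx1_mul_col big1 ?mulr0 // => l _.
by rewrite mxE sinmx_ord0 mul0r.
Qed.

Lemma mode_p_sum (i : 'I_nx) (j : 'I_ny) : (i != ord0) || (j != ord0) ->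
  \sum_k mode_p k (mxtens_index (j, i)) = 0.
Proof.
rewrite sum_tens => /orP[] h; first by rewrite [X in _ * X]cosmx_sum // mulr0.
by rewrite cosmx_sum // mul0r.
Qed.

(** * The inf-sup condition as nonnegativity of the boundary form *)

Definition pressure_of (f : 'I_nx -> 'I_ny -> R) : 'cV[R]_(ny * nx) :=
  mode_p *m (\col_k f (mxtens_unindex k).2 (mxtens_unindex k).1).

Lemma cp_pressure_of f i j : cp (pressure_of f) i j = f i j.
Proof.
rewrite /cp /pressure_of mulmxA (mulmx1C mode_p_orthV) mul1mx mxE.
by rewrite mxtens_indexK.
Qed.

Lemma pressure_of_mean f : f ord0 ord0 = 0 -> pressure_of f \in pressure R nx ny.
Proof.
move=> f0; rewrite memv_ker; apply/eqP/matrixP => k l; rewrite !ord1 meanE [RHS]mxE.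
rewrite (_ : \sum__ _ = 0) ?mul0r //.
under eq_bigr do rewrite mxE.
rewrite exchange_big big_mxtens_index big1 // => j _; rewrite big1 // => i _.
rewrite -mulr_suml mxE mxtens_indexK /=.
have [->|i0] := eqVneq i ord0; last by rewrite mode_p_sum ?i0 // mul0r.
have [->|j0] := eqVneq j ord0; last by rewrite mode_p_sum ?j0 ?orbT // mul0r.
by rewrite f0 mulr0.
Qed.

Lemma cp00_pressure p : p \in pressure R nx ny -> cp p ord0 ord0 = 0.
Proof.
rewrite memv_ker => /eqP/matrixP/(_ 0 0); rewrite meanE [RHS]mxE => /eqP.
rewrite mulf_eq0 invr_eq0 pnatr_eq0 muln_eq0 /= orbF => /eqP p0.
rewrite /cp mxE big_mxtens_index.
transitivity (Cy ord0 ord0 * Cx ord0 ord0 * \sum_i p i 0); last by rewrite p0 mulr0.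
rewrite (@big_mxtens_index _ ny nx (fun k => p k 0)) mulr_sumr.
apply: eq_bigr => j _; rewrite mulr_sumr.
apply: eq_bigr => i _; congr (_ * _).
by rewrite mxE /mode_p tensmxE cosmx_const [X in _ * X]cosmx_const.
Qed.

Definition fourier_form (gam : R) (d : R) (al : 'I_nx -> bool -> R) (be : 'I_ny -> bool -> R) :=
  boundary_form gam sx (Cx ord0) (fun i => odd i) ty (Cy ord0) (fun j => odd j) d al be.

Lemma cos_end_row m (l : bool) (j : 'I_m.+2) :
  cosmx R m (end_row m l) j = (if l then (-1) ^+ odd j else 1) * cosmx R m ord0 j.
Proof. by case: l; rewrite /= ?cosmx_last ?signr_odd ?mul1r. Qed.

Lemma sx_ge0 i : 0 <= sx i. Proof. exact: cos_eig_ge0. Qed.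
Lemma ty_ge0 j : 0 <= ty j. Proof. exact: cos_eig_ge0. Qed.

Lemma sx_eq0 i : sx i = 0 -> i = ord0.
Proof. by move=> /eqP; rewrite cos_eig_eq0 => /eqP. Qed.
Lemma ty_eq0 j : ty j = 0 -> j = ord0.
Proof. by move=> /eqP; rewrite cos_eig_eq0 => /eqP. Qed.

(* Test the pressure of coefficients 2 G / k. In (Gs u, p), a part of weight  *)
(* gam is traded for a curl and a boundary term, by a U + b V =               *)
(* (G div u + C curl u) / k for the coefficients U, V of u.                   *)
Lemma inf_sup_fourier (lam : R) : lam < 1 ->
  (forall p M, p \in pressure R nx ny ->
     (forall u, 2 * dotc (Gstar_mx nx ny 1 *m u) p <= dotc u (negL_mx nx ny 1 *m u) + M) ->
     lam * dotc p p <= M) ->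
  forall al be, (forall i b, sx i = 0 -> al i b = 0) ->
     (forall j b, ty j = 0 -> be j b = 0) ->
     0 <= fourier_form (1 - lam) 0 al be.
Proof.
move=> lam1 infsup al be al0 be0; pose gam := 1 - lam.
have gam0 : 0 < gam by rewrite subr_gt0.
pose k i j := sx i + ty j.
pose a i j := Cy ord0 j * al i (odd j); pose b i j := Cx ord0 i * be j (odd i).
pose G i j := Num.sqrt (sx i) * a i j + Num.sqrt (ty j) * b i j.
pose C i j := Num.sqrt (ty j) * a i j - Num.sqrt (sx i) * b i j.
have k0 i j : k i j = 0 -> [/\ sx i = 0 & ty j = 0].
  by move=> /eqP; rewrite /k paddr_eq0 ?sx_ge0 ?ty_ge0 // => /andP[/eqP-> /eqP->].
pose M := \sum_i \sum_j (lam ^+ 2 * (4 * G i j ^+ 2 / k i j ^+ 2) +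
     gam ^+ 2 * (4 * C i j ^+ 2 / k i j ^+ 2)) +
   gam ^+ 2 * (\sum_i \sum_c al i c ^+ 2 + \sum_j \sum_c be j c ^+ 2).
pose p := pressure_of (fun i j => 2 * G i j / k i j).
have p_pres : p \in pressure R nx ny.
  apply: pressure_of_mean.
  by rewrite /k /sx /ty !cos_eig0 addr0 invr0 mulr0.
have dpp : dotc p p = \sum_i \sum_j 4 * G i j ^+ 2 / k i j ^+ 2.
  rewrite dotc_cp; apply: eq_bigr => i _; apply: eq_bigr => j _.
  by rewrite cp_pressure_of invfM; ring.
have bnd : lam * dotc p p <= M.
  apply: infsup => // u; rewrite dotc_cp dotc_negL.
  (* These recover traces on the two sides from the even and odd combinations, since the last entry
     of a cosine mode is plus or minus its first one according to parity. *)
  pose au (i : 'I_nx) (l : bool) := (al i false + (if l then -1 else 1) * al i true) / 2.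
  pose bv (j : 'I_ny) (l : bool) := (be j false + (if l then -1 else 1) * be j true) / 2.
  have Su : \sum_i \sum_j a i j * cu u i j = \sum_i \sum_l au i l * trace_u u l i.
    apply: eq_bigr => i _; under [RHS]eq_bigr => l _ do rewrite trace_uE mulr_sumr.
    rewrite exchange_big /=; apply: eq_bigr => j _; rewrite big_bool !cos_end_row /= /a /au.
    by case: (odd j); rewrite ?expr1 ?expr0; field.
  have Sv : \sum_i \sum_j b i j * cv u i j = \sum_j \sum_l bv j l * trace_v u l j.
    rewrite exchange_big /=; apply: eq_bigr => j _.
    under [RHS]eq_bigr => l _ do rewrite trace_vE mulr_sumr.
    rewrite exchange_big /=; apply: eq_bigr => i _; rewrite big_bool !cos_end_row /= /b /bv.
    by case: (odd i); rewrite ?expr1 ?expr0; field.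
  have main : 2 * (\sum_i \sum_j cp (Gstar_mx nx ny 1 *m u) i j * cp p i j) <=
     \sum_i \sum_j k i j * (cu u i j ^+ 2 + cv u i j ^+ 2) +
     \sum_i \sum_j (lam ^+ 2 * (4 * G i j ^+ 2 / k i j ^+ 2) +
        gam ^+ 2 * (4 * C i j ^+ 2 / k i j ^+ 2)) +
     4 * gam * (\sum_i \sum_j a i j * cu u i j + \sum_i \sum_j b i j * cv u i j).
    rewrite !mulrDr !mulr_sumr -!big_split /=; apply: ler_sum => i _.
    rewrite !mulr_sumr -!big_split /=; apply: ler_sum => j _.
    rewrite cp_Gstar cp_pressure_of.
    have [kij|kij] := eqVneq (k i j) 0.
      have [si tj] := k0 _ _ kij.
      have -> : cu u i j = 0 by rewrite (sx_eq0 si) cu_ord0.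
      have -> : cv u i j = 0 by rewrite (ty_eq0 tj) cv_ord0.
      by rewrite kij !(expr0n, invr0, mulr0, mul0r, addr0).
    have k_gt0 : 0 < k i j by rewrite lt0r kij addr_ge0 ?sx_ge0 ?ty_ge0.
    rewrite /G /C; move: (a i j) (b i j) (cu u i j) (cv u i j) => A B U V.
    have rs2 : Num.sqrt (sx i) ^+ 2 = sx i by rewrite sqr_sqrtr ?sx_ge0.
    have rt2 : Num.sqrt (ty j) ^+ 2 = ty j by rewrite sqr_sqrtr ?ty_ge0.
    have kE : k i j = Num.sqrt (sx i) ^+ 2 + Num.sqrt (ty j) ^+ 2 by rewrite rs2 rt2.
    move: kE k_gt0; move: (k i j) (Num.sqrt (sx i)) (Num.sqrt (ty j)) => K x y KE K0.
    pose g := x * A + y * B; pose c := y * A - x * B.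
    (* The difference of the two sides is quadratic in (U, V) with minimum 0, attained at (w1, w2) /
       K. *)
    pose w1 := lam * (2 * g / K) * x - gam * (2 * c / K) * y.
    pose w2 := lam * (2 * g / K) * y + gam * (2 * c / K) * x.
    rewrite -subr_ge0.
    have -> : forall z, z = ((K * U - w1) ^+ 2 + (K * V - w2) ^+ 2) / K -> 0 <= z => //.
      by move=> z ->; rewrite divr_ge0 ?addr_ge0 ?sqr_ge0 // ltW.
    have Kn0 : x ^+ 2 + y ^+ 2 != 0 by rewrite -KE gt_eqF.
    by rewrite /w1 /w2 /g /c /gam KE; field.
  apply: le_trans main _; rewrite Su Sv /M.
  have tr_le (K : finType) (f g : K -> bool -> R) (h : K -> bool -> R) :
      (forall i, \sum_c h i c ^+ 2 = 2 * \sum_l f i l ^+ 2) ->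
      4 * gam * (\sum_i \sum_l f i l * g i l) <=
      2 * \sum_i \sum_l g i l ^+ 2 + gam ^+ 2 * \sum_i \sum_c h i c ^+ 2.
    move=> hf; rewrite !mulr_sumr -big_split; apply: ler_sum => i _ /=.
    rewrite hf !mulr_sumr -big_split; apply: ler_sum => l _ /=.
    have := sqr_ge0 (g i l - gam * f i l).
    have -> : (g i l - gam * f i l) ^+ 2 = g i l ^+ 2 + gam ^+ 2 * f i l ^+ 2 -
       2 * gam * (f i l * g i l) by ring.
    by lra.
  have hu : 4 * gam * (\sum_i \sum_l au i l * trace_u u l i) <=
      2 * \sum_i \sum_l trace_u u l i ^+ 2 + gam ^+ 2 * \sum_i \sum_c al i c ^+ 2.
    by apply: tr_le => i; rewrite !big_bool /au /=; field.
  have hv : 4 * gam * (\sum_j \sum_l bv j l * trace_v u l j) <=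
      2 * \sum_j \sum_l trace_v u l j ^+ 2 + gam ^+ 2 * \sum_j \sum_c be j c ^+ 2.
    by apply: tr_le => j; rewrite !big_bool /bv /=; field.
  by rewrite /k; lra.
have formE : fourier_form gam 0 al be =
   gam * (\sum_i \sum_c al i c ^+ 2 + \sum_j \sum_c be j c ^+ 2) +
   (gam * (\sum_i \sum_j 4 * C i j ^+ 2 / k i j ^+ 2) - lam * dotc p p).
  rewrite dpp /fourier_form /boundary_form; congr (_ + _).
  rewrite !mulr_sumr -sumrB; apply: eq_bigr => i _.
  rewrite !mulr_sumr -sumrB; apply: eq_bigr => j _.
  rewrite /pair_form addr0 -/(k i j) -expr2 /C /G /a /b /gam.
  by ring.
have : 0 <= gam * fourier_form gam 0 al be.
  rewrite formE; move: bnd; rewrite /M.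
  have -> : \sum_i \sum_j (lam ^+ 2 * (4 * G i j ^+ 2 / k i j ^+ 2) +
     gam ^+ 2 * (4 * C i j ^+ 2 / k i j ^+ 2)) =
     lam ^+ 2 * dotc p p + gam ^+ 2 * (\sum_i \sum_j 4 * C i j ^+ 2 / k i j ^+ 2).
    rewrite dpp !mulr_sumr -big_split; apply: eq_bigr => i _ /=.
    by rewrite !mulr_sumr -big_split.
  set y := \sum_i \sum_j 4 * C i j ^+ 2 / _; set z := \sum_i \sum_c _ + _.
  move: (dotc p p) y z => x y z bnd.
  have -> : gam * (gam * z + (gam * y - lam * x)) =
     gam ^+ 2 * z + gam ^+ 2 * y + lam ^+ 2 * x - lam * x by rewrite /gam; ring.
  by lra.
by rewrite pmulr_rge0.
Qed.

Lemma dotc_ge0 m (p : 'cV[R]_m) : 0 <= dotc p p.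
Proof. by rewrite dotcE sumr_ge0 // => i _; rewrite -expr2 sqr_ge0. Qed.

Lemma dotc_eq0 m (p : 'cV[R]_m) : dotc p p = 0 -> p = 0.
Proof.
rewrite dotcE => /eqP; rewrite psumr_eq0 => [/allP h|i _]; last by rewrite -expr2 sqr_ge0.
apply/colP => i; rewrite mxE.
by have := h i (mem_index_enum _); rewrite /= -expr2 sqrf_eq0 => /eqP.
Qed.

(** The test traces of [boundary_form_half] force 1 - lam >= 1/2, the sign condition under which the
    losses can be absorbed. *)
Lemma discrete_inf_sup_le_half (lam : R) : discrete_inf_sup nx ny lam -> lam <= 2^-1.
Proof.
(* [inf_sup_fourier] requires a constant below 1; any cap strictly between 1/2 and 1 would do. *)
move=> h; pose lam' := Num.min lam (3 / 4).
have h' : discrete_inf_sup nx ny lam'.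
  move=> p M pP hM; apply: le_trans (h p M pP hM).
  by apply: ler_wpM2r; [exact: dotc_ge0 | rewrite /lam' ge_min lexx].
have lam'1 : lam' < 1 by rewrite /lam' gt_min; apply/orP; right; lra.
have : 2^-1 <= 1 - lam'.
  apply: (boundary_form_half (s := sx) (c := Cx ord0) (sig := fun i => odd i)
    (t := ty) (e := Cy ord0) (tau := fun j => odd j)).
  - exact: sx_ge0.
  - exact: ty_ge0.
  - by move=> i /sx_eq0 ->.
  - by move=> j /ty_eq0 ->.
  - exact: cosmx_sqr_sum.
  - exact: cosmx_alt_sum.
  - exact: cosmx_eig_sum.
  - exact: cosmx_sqr_sum.
  - exact: cosmx_alt_sum.
  - exact: cosmx_eig_sum.
  - exact: inf_sup_fourier.
by rewrite /lam' minEle; case: ifP => _; lra.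
Qed.

Lemma fourier_form_ge0 (lam d : R) al be : discrete_inf_sup nx ny lam -> 0 <= lam -> 0 < d ->
  (forall i b, sx i = 0 -> al i b = 0) -> (forall j b, ty j = 0 -> be j b = 0) ->
  0 <= fourier_form (1 - lam) d al be.
Proof.
move=> h lam0 d0 al0 be0; have lam_half := discrete_inf_sup_le_half h.
apply: boundary_form_ge0 => //.
- exact: sx_ge0.
- exact: ty_ge0.
- by apply/andP; split; lra.
- by move=> x b x0; exact: cosmx_row_sum.
- by move=> x b x0; exact: cosmx_row_sum.
- by apply: inf_sup_fourier => //; lra.
Qed.

(** * Bounds for real eigenvalues *)

Lemma dotc_tr m n (A : 'M[R]_(m, n)) u v : dotc u (A *m v) = dotc (A^T *m u) v.
Proof. by rewrite /dotc trmx_mul trmxK mulmxA. Qed.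

Lemma cuD u v i j : cu (u + v) i j = cu u i j + cu v i j.
Proof. by rewrite /cu linearD mulmxDr mxE. Qed.
Lemma cvD u v i j : cv (u + v) i j = cv u i j + cv v i j.
Proof. by rewrite /cv linearD mulmxDr mxE. Qed.
Lemma cuZ x u i j : cu (x *: u) i j = x * cu u i j.
Proof. by rewrite /cu linearZ -scalemxAr mxE. Qed.
Lemma cvZ x u i j : cv (x *: u) i j = x * cv u i j.
Proof. by rewrite /cv linearZ -scalemxAr mxE. Qed.

(* Phi, Om and 2 T are the divergence, curl and boundary parts of the energy  *)
(* ((d + N) u, u); eliminating the pressure, the inequality for the form of   *)
(* parameter d becomes 0 <= (1 - mu) (mu - lam).                              *)
Lemma eigen_bounds (lam d mu : R) (u : velocity R nx ny) (p phi : 'cV[R]_(ny * nx)) :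
  discrete_inf_sup nx ny lam -> 0 <= lam -> 0 < d -> u != 0 ->
  d *: u + negL_mx nx ny 1 *m u = (Gstar_mx nx ny 1)^T *m p ->
  mu *: (d *: u + negL_mx nx ny 1 *m u) =
    d *: ((Gstar_mx nx ny 1)^T *m phi) +
    (Gstar_mx nx ny 1)^T *m (Gstar_mx nx ny 1 *m u) ->
  Gstar_mx nx ny 1 *m u = Gstar_mx nx ny 1 *m ((Gstar_mx nx ny 1)^T *m phi) ->
  lam <= mu <= 1.
Proof.
move=> hinf lam0 d0 un0 e0 e1 e2; have lam_half := discrete_inf_sup_le_half hinf.
pose k i j := sx i + ty j; pose g := cp phi.
pose U := cu u; pose V := cv u.
pose rs i := Num.sqrt (sx i); pose rt j := Num.sqrt (ty j).
have rs2 i : rs i ^+ 2 = sx i by rewrite sqr_sqrtr ?sx_ge0.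
have rt2 j : rt j ^+ 2 = ty j by rewrite sqr_sqrtr ?ty_ge0.
have kE i j : k i j = rs i ^+ 2 + rt j ^+ 2 by rewrite rs2 rt2.
have k_ge0 i j : 0 <= k i j by rewrite addr_ge0 ?sx_ge0 ?ty_ge0.
have dk_ge0 i j : 0 <= d + k i j by rewrite addr_ge0 // ltW.
have dkk_ge0 i j : 0 <= (d + k i j) * k i j * g i j ^+ 2.
  by rewrite mulr_ge0 ?sqr_ge0 // mulr_ge0.
have k0 i j : k i j = 0 -> [/\ U i j = 0, V i j = 0, rs i = 0 & rt j = 0].
  move=> /eqP; rewrite /k paddr_eq0 ?sx_ge0 ?ty_ge0 // => /andP[/eqP si /eqP tj].
  by rewrite /U /V /rs /rt si tj sqrtr0 (sx_eq0 si) (ty_eq0 tj) cu_ord0 cv_ord0.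
have divu i j : rs i * U i j + rt j * V i j = k i j * g i j.
  rewrite /U /V /rs /rt -cp_Gstar e2 cp_Gstar cu_trGstar cv_trGstar -/(g i j) kE.
  by rewrite /rs /rt; ring.
pose al i (b : bool) := trace_u u false i + (if b then -1 else 1) * trace_u u true i.
pose be j (b : bool) := trace_v u false j + (if b then -1 else 1) * trace_v u true j.
pose a i j := Cy ord0 j * al i (odd j); pose b i j := Cx ord0 i * be j (odd i).
have aE i j : \sum_l Cy (end_row n2 l) j * trace_u u l i = a i j.
  rewrite big_bool !cos_end_row /= /a /al; case: (odd j); rewrite ?expr1 ?expr0; ring.
have bE i j : \sum_l Cx (end_row n1 l) i * trace_v u l j = b i j.
  rewrite big_bool !cos_end_row /= /b /be; case: (odd i); rewrite ?expr1 ?expr0; ring.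
have eU i j : mu * ((d + k i j) * U i j + 2 * a i j) = rs i * (d + k i j) * g i j.
  have := congr1 (fun v => cu v i j) e1; rewrite cuZ !cuD !cuZ cu_negL !cu_trGstar.
  rewrite cp_Gstar divu aE -/(U i j) -/(k i j) -/(rs i) -/(g i j) => h.
  by transitivity (mu * (d * U i j + (k i j * U i j + 2 * a i j))); [ring | rewrite h; ring].
have eV i j : mu * ((d + k i j) * V i j + 2 * b i j) = rt j * (d + k i j) * g i j.
  have := congr1 (fun v => cv v i j) e1; rewrite cvZ !cvD !cvZ cv_negL !cv_trGstar.
  rewrite cp_Gstar divu bE -/(V i j) -/(k i j) -/(rt j) -/(g i j) => h.
  by transitivity (mu * (d * V i j + (k i j * V i j + 2 * b i j))); [ring | rewrite h; ring].
pose W i j := rt j * U i j - rs i * V i j.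
pose Phi := \sum_i \sum_j (d + k i j) * k i j * g i j ^+ 2.
pose Om := \sum_i \sum_j (d + k i j) * (W i j ^+ 2 / k i j).
pose T := \sum_i \sum_l trace_u u l i ^+ 2 + \sum_j \sum_l trace_v u l j ^+ 2.
have Phi0 : 0 <= Phi.
  by apply: sumr_ge0 => i _; apply: sumr_ge0.
have Om0 : 0 <= Om.
  apply: sumr_ge0 => i _; apply: sumr_ge0 => j _.
  by apply: mulr_ge0 => //; apply: divr_ge0 => //; exact: sqr_ge0.
have T0 : 0 <= T.
  by rewrite addr_ge0 //; apply: sumr_ge0 => i _; apply: sumr_ge0 => j _; exact: sqr_ge0.
have energy : dotc u (d *: u + negL_mx nx ny 1 *m u) = Phi + Om + 2 * T.
  have -> : dotc u (d *: u + negL_mx nx ny 1 *m u) =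
      d * dotc u u + dotc u (negL_mx nx ny 1 *m u).
    by rewrite /dotc mulmxDr -scalemxAr mxE [X in X + _]mxE.
  rewrite dotc_negL -/T addrA; congr (_ + _).
  rewrite dotc_cuv mulr_sumr -!big_split; apply: eq_bigr => i _ /=.
  rewrite mulr_sumr -!big_split; apply: eq_bigr => j _ /=.
  rewrite -/(U i j) -/(V i j) -/(k i j).
  have [kij|kij] := eqVneq (k i j) 0.
    by have [-> -> _ _] := k0 _ _ kij; rewrite kij !(expr0n, invr0, mulr0, mul0r, addr0).
  have -> : (d + k i j) * k i j * g i j ^+ 2 = (d + k i j) * ((k i j * g i j) ^+ 2 / k i j).
    by field.
  rewrite -divu /W; move: kij; rewrite kE => kij; field.
  exact: kij.
have power : mu * (Phi + Om + 2 * T) = Phi.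
  have := congr1 (dotc u) e1.
  have -> : dotc u (mu *: (d *: u + negL_mx nx ny 1 *m u)) =
     mu * dotc u (d *: u + negL_mx nx ny 1 *m u).
    by rewrite /dotc -scalemxAr mxE.
  rewrite energy => ->; rewrite dotc_cuv; apply: eq_bigr => i _; apply: eq_bigr => j _.
  rewrite cuD cvD cuZ cvZ !cu_trGstar !cv_trGstar cp_Gstar divu.
  rewrite -/(U i j) -/(V i j) -/(rs i) -/(rt j) -/(g i j).
  transitivity ((rs i * U i j + rt j * V i j) * (d + k i j) * g i j); first by ring.
  by rewrite divu; ring.
have tot0 : 0 < Phi + Om + 2 * T.
  rewrite -energy; have -> : dotc u (d *: u + negL_mx nx ny 1 *m u) =
      d * dotc u u + dotc u (negL_mx nx ny 1 *m u).
    by rewrite /dotc mulmxDr -scalemxAr mxE [X in X + _]mxE.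
  apply: ltr_pwDl.
    rewrite mulr_gt0 // lt0r dotc_ge0 andbT; apply: contra_neq un0; exact: dotc_eq0.
  rewrite dotc_negL -/T; apply: addr_ge0; last exact: mulr_ge0.
  apply: sumr_ge0 => i _; apply: sumr_ge0 => j _.
  by apply: mulr_ge0 (k_ge0 i j) _; apply: addr_ge0; exact: sqr_ge0.
(* If mu = 0, then Phi = 0 and u is divergence free; as (d + N) u is a gradient, the energy of u
   would vanish. *)
have mu0 : mu != 0.
  apply/eqP => l0; move: power; rewrite l0 mul0r => P0.
  have g0 i j : k i j * g i j = 0.
    move/esym/eqP: P0; rewrite psumr_eq0 => [/allP/(_ i (mem_index_enum _))|i' _]; last first.
      by apply: sumr_ge0.
    rewrite psumr_eq0 => [/allP/(_ j (mem_index_enum _))|j' _]; last first.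
      exact: dkk_ge0.
    rewrite /= mulf_eq0 sqrf_eq0 mulf_eq0 gt_eqF /=; last by rewrite ltr_pwDl.
    by move=> /orP[/eqP->|/eqP->]; rewrite ?mul0r ?mulr0.
  have : dotc u (d *: u + negL_mx nx ny 1 *m u) = 0.
    rewrite e0 dotc_tr trmxK dotc_cp big1 // => i _; rewrite big1 // => j _.
    by rewrite cp_Gstar divu g0 mul0r.
  by rewrite energy => h; move: tot0; rewrite h ltxx.
have mu_ge0 : 0 <= mu.
  by rewrite -(pmulr_lge0 _ tot0) power.
have mu_gt0 : 0 < mu by rewrite lt0r mu0.
have mu_le1 : mu <= 1.
  by rewrite -(ler_pM2r tot0) power mul1r; lra.
have Phi_gt0 : 0 < Phi by rewrite -power mulr_gt0.
have form0 : 0 <= fourier_form (1 - lam) d al be.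
  apply: fourier_form_ge0 => // [i c si|j c tj].
    by rewrite /al !trace_uE (sx_eq0 si) !big1 ?mulr0 ?addr0 // => l _; rewrite cu_ord0 mulr0.
  by rewrite /be !trace_vE (ty_eq0 tj) !big1 ?mulr0 ?addr0 // => l _; rewrite cv_ord0 mulr0.
have formE : mu ^+ 2 * fourier_form (1 - lam) d al be =
    mu ^+ 2 * (1 - lam) * (2 * T + Om) - lam * (1 - mu) ^+ 2 * Phi.
  have sq2 : \sum_i \sum_c al i c ^+ 2 + \sum_j \sum_c be j c ^+ 2 = 2 * T.
    rewrite /T mulrDr !mulr_sumr; congr (_ + _); apply: eq_bigr => i _;
    by rewrite !big_bool /al /be /=; ring.
  rewrite /fourier_form /boundary_form sq2.
  have -> : \sum_i \sum_j pair_form (1 - lam) d (sx i) (ty j) (Cy ord0 j * al i (odd j))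
     (Cx ord0 i * be j (odd i)) =
     \sum_i \sum_j ((1 - lam) * ((d + k i j) * (W i j ^+ 2 / k i j)) -
        lam * (1 - mu) ^+ 2 / mu ^+ 2 * ((d + k i j) * k i j * g i j ^+ 2)).
    apply: eq_bigr => i _; apply: eq_bigr => j _.
    rewrite /pair_form -/(a i j) -/(b i j) -/(rs i) -/(rt j) -/(k i j).
    have kd0 : d + k i j != 0 by rewrite gt_eqF // ltr_pwDl.
    (* This is the curl of the equations [eU] and [eV], whose right-hand sides form a gradient; [GE]
       below is their divergence. *)
    have CE : rt j * a i j - rs i * b i j = - ((d + k i j) * W i j) / 2.
      have : mu * ((d + k i j) * W i j + 2 * (rt j * a i j - rs i * b i j)) = 0.
        transitivity (rt j * (mu * ((d + k i j) * U i j + 2 * a i j)) -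
           rs i * (mu * ((d + k i j) * V i j + 2 * b i j))); first by rewrite /W; ring.
        by rewrite eU eV; ring.
      by move/eqP; rewrite mulf_eq0 (negPf mu0) /= => /eqP h; lra.
    have GE : rs i * a i j + rt j * b i j = (1 - mu) / mu * ((d + k i j) * k i j * g i j) / 2.
      have h : mu * ((d + k i j) * (k i j * g i j) + 2 * (rs i * a i j + rt j * b i j)) =
         (d + k i j) * k i j * g i j.
        rewrite -divu.
        transitivity (rs i * (mu * ((d + k i j) * U i j + 2 * a i j)) +
           rt j * (mu * ((d + k i j) * V i j + 2 * b i j))); first by ring.
        by rewrite eU eV kE; ring.
      apply: (mulfI mu0).
      transitivity ((mu * ((d + k i j) * (k i j * g i j) + 2 * (rs i * a i j + rt j * b i j)) -
        mu * ((d + k i j) * (k i j * g i j))) / 2); first by field.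
      by rewrite h; field.
    rewrite CE GE (addrC (k i j) d).
    have [kij|kij] := eqVneq (k i j) 0.
      by rewrite kij !(expr0n, invr0, mulr0, mul0r, addr0, subr0).
    by field; rewrite kd0 kij mu0.
  rewrite (_ : \sum_i \sum_j (_ - _) =
     (1 - lam) * Om - lam * (1 - mu) ^+ 2 / mu ^+ 2 * Phi); first by field.
  rewrite /Om /Phi !mulr_sumr -sumrB; apply: eq_bigr => i _.
  by rewrite !mulr_sumr -sumrB.
(* By [power], mu (2 T + Om) = (1 - mu) Phi; substituting this in [formE] leaves the product times
   Phi > 0. *)
have : 0 <= (1 - mu) * (mu * (1 - lam) - lam * (1 - mu)).
  rewrite -(pmulr_lge0 _ Phi_gt0).
  have -> : (1 - mu) * (mu * (1 - lam) - lam * (1 - mu)) * Phi =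
     mu ^+ 2 * fourier_form (1 - lam) d al be.
    rewrite formE.
    have -> : mu ^+ 2 * (1 - lam) * (2 * T + Om) =
      mu * (1 - lam) * (mu * (Phi + Om + 2 * T) - mu * Phi) by ring.
    by rewrite power; ring.
  by rewrite mulr_ge0 // sqr_ge0.
have -> : mu * (1 - lam) - lam * (1 - mu) = mu - lam by ring.
(* The product carries no information at mu = 1, where lam <= 1/2 suffices. *)
rewrite mu_le1 andbT; have [->|mu1] := eqVneq mu 1; first by lra.
by rewrite pmulr_rge0 ?subr_ge0 // subr_gt0 lt_neqAle mu1.
Qed.
Lemma dotc_negL_ge0 (u : velocity R nx ny) : 0 <= dotc u (negL_mx nx ny 1 *m u).
Proof.
rewrite dotc_negL; apply: addr_ge0; last apply: mulr_ge0 => //; last first.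
  by apply: addr_ge0; apply: sumr_ge0 => i _; apply: sumr_ge0 => l _; exact: sqr_ge0.
apply: sumr_ge0 => i _; apply: sumr_ge0 => j _.
by apply: mulr_ge0; apply: addr_ge0; rewrite ?sqr_ge0 ?sx_ge0 ?ty_ge0.
Qed.

(** The gradient multiplies each coefficient by sqrt s and sqrt t, which both vanish only at the
    constant mode, excluded by the zero mean. *)
Lemma trGstar_eq0 (p : 'cV[R]_(ny * nx)) : p \in pressure R nx ny -> (Gstar_mx nx ny 1)^T *m p = 0 -> p = 0.
Proof.
move=> pP Gp0; apply: dotc_eq0; rewrite dotc_cp big1 // => i _; rewrite big1 // => j _.
suff -> : cp p i j = 0 by rewrite mul0r.
have := congr1 (fun u => cu u i j) Gp0; rewrite -(scale0r 0) cuZ mul0r cu_trGstar.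
move=> /eqP; rewrite mulf_eq0 sqrtr_eq0 => /orP[si|/eqP //].
have := congr1 (fun u => cv u i j) Gp0; rewrite -(scale0r 0) cvZ mul0r cv_trGstar.
move=> /eqP; rewrite mulf_eq0 sqrtr_eq0 => /orP[tj|/eqP //].
have -> : i = ord0 by apply: sx_eq0; apply: le_anti; rewrite si sx_ge0.
have -> : j = ord0 by apply: ty_eq0; apply: le_anti; rewrite tj ty_ge0.
exact: cp00_pressure.
Qed.
End Fourier.

(** * Transfer to mesh sizes given as integers at least 2 *)

Section Mesh.
Context (R : realType) (mx my : nat).
Context (mx2 : (2 <= mx)%N) (my2 : (2 <= my)%N).
Local Notation Gs := (Gstar_mx mx my (1 : R)).
Local Notation negL1 := (negL_mx mx my (1 : R)).

Lemma mesh_negL_ge0 (u : velocity R mx my) : 0 <= dotc u (negL1 *m u).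
Proof.
case: mx mx2 my my2 u => [|[|n1]] // _ [|[|n2]] // _ u; exact: dotc_negL_ge0.
Qed.

Lemma mesh_lapP_eq0 (p : 'cV[R]_(my * mx)) :
  p \in pressure R mx my -> Gs *m (Gs^T *m p) = 0 -> p = 0.
Proof.
move=> pP GG0; have : dotc p (Gs *m (Gs^T *m p)) = 0.
  by rewrite GG0 /dotc mulmx0 mxE.
rewrite dotc_tr => /dotc_eq0.
case: mx mx2 my my2 p pP {GG0} => [|[|n1]] // _ [|[|n2]] // _ p; exact: trGstar_eq0.
Qed.

Lemma mesh_eigen_bounds (lam d mu : R) (u : velocity R mx my) (p phi : 'cV[R]_(my * mx)) :
  discrete_inf_sup mx my lam -> 0 <= lam -> 0 < d -> u != 0 ->
  d *: u + negL1 *m u = Gs^T *m p ->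
  mu *: (d *: u + negL1 *m u) = d *: (Gs^T *m phi) + Gs^T *m (Gs *m u) ->
  Gs *m u = Gs *m (Gs^T *m phi) ->
  lam <= mu <= 1.
Proof.
case: mx mx2 my my2 u p phi => [|[|n1]] // _ [|[|n2]] // _ u p phi; exact: eigen_bounds.
Qed.
End Mesh.

(** * From the inf-sup condition to its dual form for h = 1 *)

Section InfSupMesh.
Context (R : realType) (a b : R) (g : mesh a b) (beta : R).
Local Notation hg := (Defs.h g).

Lemma lapUE (F : fieldType) mx my (h : F) (u : velocity F mx my) :
  (- lapU mx my h) u = h ^- 2 *: (negL_mx mx my 1 *m u).
Proof. by rewrite opp_lfunE lfunE /= mulNmx opprK negL_mx1 -scalemxAl. Qed.

Lemma dotcZl (m : nat) (c : R) (u v : 'cV[R]_m) : dotc (c *: u) v = c * dotc u v.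
Proof. by rewrite /dotc linearZ -scalemxAl mxE. Qed.
Lemma dotcZr (m : nat) (c : R) (u v : 'cV[R]_m) : dotc u (c *: v) = c * dotc u v.
Proof. by rewrite /dotc -scalemxAr mxE. Qed.
Lemma dotcC (m : nat) (u v : 'cV[R]_m) : dotc u v = dotc v u.
Proof. by rewrite !dotcE; apply: eq_bigr => i _; rewrite mulrC. Qed.

(** Such an M bounds the supremum by h sqrt M, while the weighted norm of p is h times the Euclidean
    one, so the powers of h cancel. *)
Lemma discrete_inf_sup_sqr : 0 < beta -> inf_sup g beta ->
  discrete_inf_sup (nx g) (ny g) (beta ^+ 2).
Proof.
move=> beta0 hinf p M pP hM.
have h0 : 0 < hg := h_gt0 g.
have M0 : 0 <= M.
  have d0 m (v : 'cV[R]_m) : dotc 0 v = 0 by rewrite -(scale0r 0) dotcZl mul0r.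
  by have := hM 0; rewrite !mulmx0 !d0 mulr0 add0r.
have Ge u : dotc (Gstar_mx (nx g) (ny g) 1 *m u) p ^+ 2 <=
    M * dotc u (negL_mx (nx g) (ny g) 1 *m u).
  set x := dotc (_ *m u) p; set y := dotc u _.
  have hq c : 2 * (c * x) <= c ^+ 2 * y + M.
    by have := hM (c *: u); rewrite -!scalemxAr !dotcZl dotcZr mulrA -expr2.
  have y0 : 0 <= y by apply: mesh_negL_ge0; [exact: nx_ge2 | exact: ny_ge2].
  have [yE|yn] := eqVneq y 0.
    have [->|xn] := eqVneq x 0; first by rewrite expr0n yE mulr0.
    (* If the energy y vanished with x nonzero, this multiple of u would give 2 (M + 1) <= M. *)
    have := hq ((M + 1) / x); rewrite yE mulr0 add0r -mulrA mulVf // mulr1; lra.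
  have := hq (x / y).
  have -> : (x / y) ^+ 2 * y = x ^+ 2 / y by field.
  have -> : 2 * (x / y * x) = 2 * (x ^+ 2 / y) by field.
  move=> h; have : x ^+ 2 / y <= M by lra.
  by rewrite ler_pdivrMr // lt0r yn.
pose q := vsproj (pressure R (nx g) (ny g)) p.
have qE : vsval q = p by exact: vsprojK.
have := hinf q; rewrite /norm0 /inner qE -/(dotc p p).
have le_sup : (ereal_sup [set (inner g (vsval ((- Defs.div (nx g) (ny g) hg) u)) p / norm1 u)%:E
    | u in [set u | u != 0%R]] <= (hg * Num.sqrt M)%:E)%E.
  apply: ge_ereal_sup => _ [u /= _ <-]; rewrite lee_fin.
  have -> : inner g (vsval ((- Defs.div (nx g) (ny g) hg) u)) p =
      hg * dotc (Gstar_mx (nx g) (ny g) 1 *m u) p.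
    rewrite opp_lfunE linearN /= divE mulNmx opprK /inner Gstar_mx1 -scalemxAl.
    rewrite -/(dotc (_ *: _) p) dotcZl mulrA expr2 mulfK //.
    by rewrite gt_eqF.
  have -> : norm1 u = Num.sqrt (dotc u (negL_mx (nx g) (ny g) 1 *m u)).
    rewrite /norm1 lapUE /inner -/(dotc (_ *: _) u) dotcZl mulrA mulfV ?mul1r; last first.
      by rewrite expf_neq0 // gt_eqF.
    by rewrite dotcC.
  have := Ge u; set x := dotc _ p; set y := dotc u _ => xy.
  (* A zero norm makes the quotient 0 by the convention on division, and the bound is trivial. *)
  have [yE|yn] := eqVneq (Num.sqrt y) 0.
    by rewrite yE invr0 mulr0 mulr_ge0 ?sqrtr_ge0 // ltW.
  have yp : 0 < Num.sqrt y by rewrite lt0r yn sqrtr_ge0.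
  rewrite ler_pdivrMr // -mulrA; apply: ler_wpM2l; first exact: ltW.
  rewrite -sqrtrM //; apply: le_trans (ler_norm x) _.
  by rewrite -sqrtr_sqr ler_wsqrtr.
move=> /le_trans /(_ le_sup); rewrite lee_fin sqrtrM ?sqr_ge0 // sqrtr_sqr gtr0_norm //.
rewrite mulrCA ler_pM2l // => hb.
rewrite -(sqr_sqrtr (dotc_ge0 p)) -exprMn -(sqr_sqrtr M0).
by rewrite ler_sqr // nnegrE ?mulr_ge0 ?sqrtr_ge0 // ltW.
Qed.
End InfSupMesh.

(** * From complex to real vectors *)

Section Map.
Context (F K : fieldType) (f : {rmorphism F -> K}).
Local Notation "A ^f" := (map_mx f A) : ring_scope.

Lemma map_B_D m : (B_D F m)^f = B_D K m.
Proof. by apply/matrixP => i j; rewrite !mxE rmorphB !rmorph_nat. Qed.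

Lemma map_T_D m : (T_D F m)^f = T_D K m.
Proof. by rewrite /T_D map_mxM -map_trmx map_B_D. Qed.

Lemma map_T_E m : (T_E F m)^f = T_E K m.
Proof.
rewrite /T_E map_mxD map_mxZ rmorph_nat /T_N map_mxM -map_trmx map_B_D; congr (_ + _ *: _).
rewrite /E_0 map_diag_mx; congr diag_mx.
by apply/rowP => i; rewrite !mxE rmorph_nat.
Qed.

Lemma map_negL_mx mx my h : (negL_mx mx my h)^f = negL_mx mx my (f h).
Proof.
rewrite /negL_mx map_mxZ fmorphV rmorphXn map_block_mx !map_mx0 !map_mxD !map_mxT.
by rewrite !map_mx1 !map_T_D !map_T_E.
Qed.

Lemma map_Gstar_mx mx my h : (Gstar_mx mx my h)^f = Gstar_mx mx my (f h).
Proof. by rewrite /Gstar_mx map_mxZ fmorphV map_row_mx !map_mxT !map_mx1 !map_B_D. Qed.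

Lemma map_const_mean n : (const_mx n%:R^-1 : 'rV_n)^f = const_mx n%:R^-1.
Proof. by apply/rowP => i; rewrite !mxE fmorphV rmorph_nat. Qed.

Lemma trmx_negL mx my (h : F) : (negL_mx mx my h)^T = negL_mx mx my h.
Proof.
have sD m : (T_D F m)^T = T_D F m by rewrite /T_D trmx_mul trmxK.
have sE m : (T_E F m)^T = T_E F m.
  by rewrite /T_E linearD linearZ /= /T_N trmx_mul trmxK /E_0 tr_diag_mx.
by rewrite /negL_mx linearZ /= tr_block_mx !trmx0 !linearD /= !trmx_tens !trmx1 !sD !sE.
Qed.
End Map.

Section RealLinear.
Context (R : realType) (f : R[i] -> R).
Hypothesis fD : forall x y, f (x + y) = f x + f y.
Hypothesis fZ : forall a x, f (a%:C * x) = a * f x.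
Local Notation "A %:CM" := (map_mx (real_complex R) A) (at level 2).

Lemma map_mxD_real m n (A B : 'M[R[i]]_(m, n)) : map_mx f (A + B) = map_mx f A + map_mx f B.
Proof. by apply/matrixP => i j; rewrite !mxE fD. Qed.

Lemma map_mxZ_real m n a (A : 'M[R[i]]_(m, n)) : map_mx f (a%:C *: A) = a *: map_mx f A.
Proof. by apply/matrixP => i j; rewrite !mxE fZ. Qed.

Lemma map_mxM_real m n p (A : 'M[R]_(m, n)) (B : 'M[R[i]]_(n, p)) :
  map_mx f (A%:CM *m B) = A *m map_mx f B.
Proof.
have f0 : f 0 = 0 by have := fZ 0 0; rewrite !mul0r.
apply/matrixP => i j; rewrite !mxE (big_morph f fD f0).
by apply: eq_bigr => k _; rewrite !mxE fZ.
Qed.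
End RealLinear.

Lemma ReD (R : realType) (x y : R[i]) : complex.Re (x + y) = complex.Re x + complex.Re y.
Proof. by case: x y => [a b] [c d]. Qed.
Lemma ImD (R : realType) (x y : R[i]) : complex.Im (x + y) = complex.Im x + complex.Im y.
Proof. by case: x y => [a b] [c d]. Qed.
Lemma ReZ (R : realType) (a : R) (x : R[i]) : complex.Re (a%:C * x) = a * complex.Re x.
Proof. by case: x => x y; simpc. Qed.
Lemma ImZ (R : realType) (a : R) (x : R[i]) : complex.Im (a%:C * x) = a * complex.Im x.
Proof. by case: x => x y; simpc. Qed.

Section Complex.
Context (R : realType).
Local Notation Rmx A := (map_mx (@complex.Re R) A).
Local Notation Imx A := (map_mx (@complex.Im R) A).

Lemma Rmx_scale m n (l : R[i]) (A : 'M[R[i]]_(m, n)) :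
  Rmx (l *: A) = complex.Re l *: Rmx A - complex.Im l *: Imx A.
Proof. by apply/matrixP => i j; rewrite !mxE; case: l; case: (A i j) => *; simpc. Qed.

Lemma Imx_scale m n (l : R[i]) (A : 'M[R[i]]_(m, n)) :
  Imx (l *: A) = complex.Re l *: Imx A + complex.Im l *: Rmx A.
Proof. by apply/matrixP => i j; rewrite !mxE; case: l; case: (A i j) => *; simpc. Qed.

Lemma complex_mx_eq0 m n (A : 'M[R[i]]_(m, n)) : Rmx A = 0 -> Imx A = 0 -> A = 0.
Proof.
move=> /matrixP hR /matrixP hI; apply/matrixP => i j.
by have := hR i j; have := hI i j; rewrite !mxE; case: (A i j) => x y /= -> ->.
Qed.

Lemma dotcDr (m : nat) (u v w : 'cV[R]_m) : dotc u (v + w) = dotc u v + dotc u w.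
Proof. by rewrite /dotc mulmxDr mxE. Qed.

Context (mx my : nat).
Context (mx2 : (2 <= mx)%N) (my2 : (2 <= my)%N).
Local Notation Gs := (Gstar_mx mx my (1 : R)).
Local Notation negL1 := (negL_mx mx my (1 : R)).
Local Notation Gc := (Gstar_mx mx my (1 : R[i])).
Local Notation negLc := (negL_mx mx my (1 : R[i])).

(** All matrices are real, so real and imaginary parts satisfy a coupled real system; symmetry
    forces l to be real, which decouples it, and either nonzero part is then a real eigenvector. *)
Lemma complex_eigen_bounds (lam d : R) (l : R[i]) (u : velocity R[i] mx my)
    (p phi : 'cV[R[i]]_(my * mx)) :
  discrete_inf_sup mx my lam -> 0 <= lam -> 0 < d -> u != 0 ->
  d%:C *: u + negLc *m u = Gc^T *m p ->
  l *: (d%:C *: u + negLc *m u) = d%:C *: (Gc^T *m phi) + Gc^T *m (Gc *m u) ->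
  Gc *m u = Gc *m (Gc^T *m phi) ->
  lam%:C <= l <= 1.
Proof.
move=> hinf lam0 d0 un0.
have <- : map_mx (real_complex R) negL1 = negLc by rewrite map_negL_mx rmorph1.
have <- : map_mx (real_complex R) Gs = Gc by rewrite map_Gstar_mx rmorph1.
rewrite map_trmx => e0 e1 e2.
pose ReE := (map_mxD_real (@ReD R), map_mxM_real (@ReD R) (@ReZ R), map_mxZ_real (@ReZ R)).
pose ImE := (map_mxD_real (@ImD R), map_mxM_real (@ImD R) (@ImZ R), map_mxZ_real (@ImZ R)).
have := congr1 (fun v => Rmx v) e0; rewrite /= !ReE => e0R.
have := congr1 (fun v => Imx v) e0; rewrite /= !ImE => e0I.
have := congr1 (fun v => Rmx v) e2; rewrite /= !ReE => e2R.
have := congr1 (fun v => Imx v) e2; rewrite /= !ImE => e2I.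
have := congr1 (fun v => Rmx v) e1; rewrite /= Rmx_scale !(ReE, ImE) => e1R.
have := congr1 (fun v => Imx v) e1; rewrite /= Imx_scale !(ReE, ImE) => e1I.
have u_neq0 : (Rmx u != 0) || (Imx u != 0).
  by rewrite -negb_and; apply: contra un0 => /andP[/eqP h1 /eqP h2]; rewrite (complex_mx_eq0 h1).
move: (Rmx u) (Imx u) (Rmx p) (Imx p) (Rmx phi) (Imx phi) u_neq0 e0R e0I e1R e1I e2R e2I.
move=> u1 u2 p1 p2 f1 f2 un e0R e0I e1R e1I e2R e2I {e0 e1 e2}.
pose A (v : velocity R mx my) := d *: v + negL1 *m v.
pose Fr (v : velocity R mx my) (f : 'cV[R]_(my * mx)) := d *: (Gs^T *m f) + Gs^T *m (Gs *m v).
have A_sym v w : dotc v (A w) = dotc w (A v).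
  rewrite /A !dotcDr !dotcZr (dotcC v w) (dotc_tr negL1) trmx_negL.
  by rewrite (dotcC (_ *m v)).
have A_ge0 v : 0 <= dotc v (A v).
  rewrite /A dotcDr dotcZr; apply: addr_ge0; last exact: mesh_negL_ge0.
  by apply: mulr_ge0; [exact: ltW | exact: dotc_ge0].
have A_eq0 v : v != 0 -> 0 < dotc v (A v).
  move=> vn; rewrite /A dotcDr dotcZr; apply: ltr_pwDl; last exact: mesh_negL_ge0.
  rewrite mulr_gt0 // lt0r dotc_ge0 andbT; apply: contra_neq vn; exact: dotc_eq0.
(* On pairs where the gradient of f has the divergence of v, the potential term is the product of
   the gradients of f and k, which is symmetric. *)
have F_sym v f w k : Gs *m v = Gs *m (Gs^T *m f) -> Gs *m w = Gs *m (Gs^T *m k) ->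
    dotc v (Fr w k) = dotc w (Fr v f).
  move=> hv hw; rewrite /Fr !dotcDr !dotcZr !(dotc_tr Gs^T) !trmxK.
  rewrite (dotcC (Gs *m v) (Gs *m w)); congr (_ * _ + _).
  have e x k' : dotc (Gs *m x) k' = dotc x (Gs^T *m k') by rewrite dotc_tr trmxK.
  by rewrite hv hw !e dotcC.
(* The real part is tested with u2 and the imaginary part with u1; by symmetry, the difference is Im
   l times the total energy. *)
have Im0 : complex.Im l = 0.
  have h1 : dotc u2 (Fr u1 f1) =
      complex.Re l * dotc u2 (A u1) - complex.Im l * dotc u2 (A u2).
    by rewrite /Fr -e1R dotcDr -scaleNr !dotcZr mulNr.
  have h2 : dotc u1 (Fr u2 f2) =
      complex.Re l * dotc u1 (A u2) + complex.Im l * dotc u1 (A u1).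
    by rewrite /Fr -e1I dotcDr !dotcZr.
  have : complex.Im l * (dotc u1 (A u1) + dotc u2 (A u2)) = 0.
    by move: h1; rewrite -(F_sym _ _ _ _ e2R e2I) h2 (A_sym u1 u2); lra.
  move=> /eqP; rewrite mulf_eq0 => /orP[/eqP //|].
  rewrite paddr_eq0 // => /andP[z1 z2].
  by case/orP: un => /A_eq0; rewrite ?(eqP z1) ?(eqP z2) ltxx.
move: e1R e1I; rewrite Im0 !scale0r subr0 addr0 => e1R e1I.
have bnd : lam <= complex.Re l <= 1.
  case/orP: un => un.
    exact: (mesh_eigen_bounds mx2 my2 hinf lam0 d0 un e0R e1R e2R).
  exact: (mesh_eigen_bounds mx2 my2 hinf lam0 d0 un e0I e1I e2I).
by rewrite !lecE /= Im0 eqxx.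
Qed.

Lemma complex_lapP_eq0 (p : 'cV[R[i]]_(my * mx)) :
  p \in pressure R[i] mx my -> Gc *m (Gc^T *m p) = 0 -> p = 0.
Proof.
have <- : map_mx (real_complex R) Gs = Gc by rewrite map_Gstar_mx rmorph1.
rewrite map_trmx !memv_ker !lfunE /= => /eqP pP Gp0.
rewrite -(map_const_mean (real_complex R)) in pP.
have zR m n : Rmx (0 : 'M_(m, n)) = 0 by apply/matrixP => i j; rewrite !mxE.
have zI m n : Imx (0 : 'M_(m, n)) = 0 by apply/matrixP => i j; rewrite !mxE.
apply: complex_mx_eq0; apply: mesh_lapP_eq0 => //.
- by rewrite memv_ker lfunE /= -(map_mxM_real (@ReD R) (@ReZ R)) pP zR.
- by rewrite -!(map_mxM_real (@ReD R) (@ReZ R)) Gp0 zR.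
- by rewrite memv_ker lfunE /= -(map_mxM_real (@ImD R) (@ImZ R)) pP zI.
- by rewrite -!(map_mxM_real (@ImD R) (@ImZ R)) Gp0 zI.
Qed.

Lemma complex_negL_eq0 (d : R) (u : velocity R[i] mx my) :
  0 < d -> d%:C *: u + negLc *m u = 0 -> u = 0.
Proof.
have <- : map_mx (real_complex R) negL1 = negLc by rewrite map_negL_mx rmorph1.
have zR m n : Rmx (0 : 'M_(m, n)) = 0 by apply/matrixP => i j; rewrite !mxE.
have zI m n : Imx (0 : 'M_(m, n)) = 0 by apply/matrixP => i j; rewrite !mxE.
have real0 (v : velocity R mx my) : 0 < d -> d *: v + negL1 *m v = 0 -> v = 0.
  move=> d0 e; apply: dotc_eq0; have := mesh_negL_ge0 mx2 my2 v; have := dotc_ge0 v.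
  have : dotc v (d *: v + negL1 *m v) = 0 by rewrite e -(scale0r 0) dotcZr mul0r.
  rewrite dotcDr dotcZr => h1 h2 h3; apply/eqP; rewrite eq_le h2 andbT.
  by rewrite -(pmulr_rle0 _ d0); lra.
move=> d0 e; apply: complex_mx_eq0; apply: real0 => //.
  rewrite -(map_mxM_real (@ReD R) (@ReZ R)) -(map_mxZ_real (@ReZ R)).
  by rewrite -(map_mxD_real (@ReD R)) e zR.
rewrite -(map_mxM_real (@ImD R) (@ImZ R)) -(map_mxZ_real (@ImZ R)).
by rewrite -(map_mxD_real (@ImD R)) e zI.
Qed.


End Complex.

Lemma lker_eq0 (F : fieldType) (V W : vectType F) (f : 'Hom(V, W)) :
  (forall x, f x = 0 -> x = 0) -> lker f == 0%VS.
Proof.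
move=> f0; rewrite -subv0; apply/subvP => x; rewrite memv_ker => /eqP/f0 ->.
exact: mem0v.
Qed.

Lemma leigenvalueP (F : fieldType) (V : vectType F) (f : 'End(V)) a :
  reflect (exists2 x, x != 0 & f x = a *: x) (passmx.leigenvalue f a).
Proof.
apply: (iffP idP) => [fa|[x x0 fx]].
  exists (vpick (passmx.leigenspace f a)); first by rewrite vpick0.
  apply/eqP; rewrite -subr_eq0.
  have := memv_pick (passmx.leigenspace f a).
  by rewrite memv_ker add_lfunE opp_lfunE scale_lfunE id_lfunE.
apply: contra x0 => /eqP f0; rewrite -memv0 -f0 memv_ker.
by rewrite add_lfunE opp_lfunE scale_lfunE id_lfunE fx subrr.
Qed.

(** * The preconditioned operators *)

Section Operators.
Context (F : fieldType) (mx my : nat) (h eps : F).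

Lemma velAE u : velA mx my h eps u = u + eps ^+ 2 *: (h ^- 2 *: (negL_mx mx my 1 *m u)).
Proof.
rewrite /velA add_lfunE id_lfunE; congr (_ + _).
by rewrite -scalerN scale_lfunE lapUE.
Qed.

Lemma lapPE p :
  vsval ((- lapP mx my h) p) =
  h ^- 2 *: (Gstar_mx mx my 1 *m ((Gstar_mx mx my 1)^T *m vsval p)).
Proof.
rewrite opp_lfunE linearN /= comp_lfunE divE gradE mulNmx opprK Gstar_mx1.
move: (Gstar_mx mx my 1) => G1.
by rewrite linearZ /= -!scalemxAl -scalemxAr scalerA -invfM.
Qed.

Lemma schurE p :
  vsval (schur mx my h eps p) =
  h^-1 *: (Gstar_mx mx my 1 *m ((velA mx my h eps)^-1%VF (grad mx my h p))).
Proof.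
rewrite opp_lfunE linearN /= !comp_lfunE divE mulNmx opprK Gstar_mx1.
by rewrite -scalemxAl.
Qed.

(** The product is block upper triangular, with the identity on velocities and the preconditioned
    Schur complement on pressures: the second component of an eigenvector either is a Schur
    eigenvector or vanishes, and then a = 1. *)
Lemma P1M_eigenvalue a : lker (velA mx my h eps) == 0%VS -> lker (- lapP mx my h) == 0%VS ->
  passmx.leigenvalue (P1inv mx my h eps \o stokesM mx my h eps)%VF a ->
  a = 1 \/ passmx.leigenvalue (schur_prec mx my h eps \o schur mx my h eps)%VF a.
Proof.
move=> kerA kerL /leigenvalueP[[u p] x0].
set w := (velA mx my h eps)^-1%VF (grad mx my h p).
set q := (- lapP mx my h)^-1%VF (schur mx my h eps p).
have schur_w : schur mx my h eps p = - (div mx my h w).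
  by rewrite /schur opp_lfunE !comp_lfunE.
have lap_q : lapP mx my h q = - schur mx my h eps p.
  by rewrite -[in RHS](lker0_lfunVK kerL (schur _ _ _ _ p)) -/q opp_lfunE opprK.
have -> : (P1inv mx my h eps \o stokesM mx my h eps)%VF (u, p) =
    (u + w - grad mx my h q, (schur_prec mx my h eps \o schur mx my h eps)%VF p).
  rewrite /P1inv /stokesM !comp_lfunE !block_lfunE /=.
  rewrite !zero_lfunE !id_lfunE !addr0 !add0r linearD /= lker0_lfunK // -/w.
  have -> : (- div mx my h) (u + w) + (- \1%VF) ((- div mx my h) u) = schur mx my h eps p.
    by rewrite schur_w !opp_lfunE id_lfunE linearD opprD opprK addrAC addNr add0r.
  rewrite -/q opp_lfunE add_lfunE id_lfunE -scaleNr scale_lfunE lap_q scaleNr scalerN opprK.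
  by rewrite /schur_prec add_lfunE scale_lfunE id_lfunE.
move=> [eu ep]; have [p0|pn] := eqVneq p 0; last by right; apply/leigenvalueP; exists p.
left; move: eu x0; rewrite /q /w p0 !linear0 !addr0 => eu x0.
have un : u != 0 by apply: contra x0 => /eqP ->.
apply/esym/eqP; rewrite -subr_eq0 -(mulr1 (_ - _)).
have : (1 - a) *: u = 0 by rewrite scalerBl scale1r -eu subrr.
by move/eqP; rewrite scaler_eq0 (negPf un) orbF mulr1.
Qed.
End Operators.

(** * Spectrum of the preconditioned Schur complement *)

Section Spectrum.
Context (R : realType) (mx my : nat).
Context (mx2 : (2 <= mx)%N) (my2 : (2 <= my)%N).
Context (h eps : R) (h0 : 0 < h) (eps0 : 0 < eps).

Local Lemma h_neq0 : h%:C != 0.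
Proof. by rewrite eq_complex /= eqxx andbT gt_eqF. Qed.
Local Lemma eps_neq0 : eps%:C != 0.
Proof. by rewrite eq_complex /= eqxx andbT gt_eqF. Qed.
(* Multiplying A by d removes h and eps from the Laplacian.                   *)
Let d := h ^+ 2 / eps ^+ 2.
Local Lemma d_gt0 : 0 < d.
Proof. by rewrite divr_gt0 ?exprn_gt0. Qed.
Local Lemma dE : d%:C = h%:C ^+ 2 / eps%:C ^+ 2.
Proof. by rewrite /d rmorphM fmorphV !rmorphXn. Qed.

Lemma scaled_velA u : d%:C *: velA mx my h%:C eps%:C u = d%:C *: u + negL_mx mx my 1 *m u.
Proof.
rewrite velAE scalerDr !scalerA dE; congr (_ + _); rewrite -[RHS]scale1r; congr (_ *: _).
by field; rewrite h_neq0 eps_neq0.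
Qed.

Lemma lker_velA : lker (velA mx my h%:C eps%:C) == 0%VS.
Proof.
apply: lker_eq0 => u Au0; apply: (complex_negL_eq0 mx2 my2 d_gt0).
by rewrite -scaled_velA Au0 scaler0.
Qed.

Lemma lker_lapP : lker (- lapP mx my h%:C) == 0%VS.
Proof.
apply: lker_eq0 => p Lp0; apply: val_inj; rewrite /=.
apply: (complex_lapP_eq0 mx2 my2); first exact: subvsP.
apply/eqP; have := congr1 vsval Lp0; rewrite lapPE linear0 => /eqP.
by rewrite scaler_eq0 invr_eq0 expf_eq0 (negPf h_neq0) andbF.
Qed.

(** Applying the gradient to the eigenvalue equation turns it into a relation between velocities, to
    which [complex_eigen_bounds] applies. *)
Lemma schur_eigenvalue_bounds lam l : discrete_inf_sup mx my lam -> 0 <= lam ->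
  passmx.leigenvalue (schur_prec mx my h%:C eps%:C \o schur mx my h%:C eps%:C)%VF l ->
  lam%:C <= l <= 1.
Proof.
move=> hinf lam0 /leigenvalueP[p pn].
rewrite comp_lfunE /schur_prec add_lfunE scale_lfunE id_lfunE.
set q := (- lapP mx my h%:C)^-1%VF _ => ep.
pose u := (velA mx my h%:C eps%:C)^-1%VF (grad mx my h%:C p).
have hn := h_neq0; have en := eps_neq0.
have Au : velA mx my h%:C eps%:C u = h%:C^-1 *: ((Gstar_mx mx my 1)^T *m vsval p).
  by rewrite (lker0_lfunVK lker_velA) gradE Gstar_mx1 linearZ /= -scalemxAl.
have sE : vsval (schur mx my h%:C eps%:C p) = h%:C^-1 *: (Gstar_mx mx my 1 *m u).
  exact: schurE.
have un : u != 0.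
  apply: contra pn => /eqP u0; apply/eqP/val_inj => /=.
  apply: (complex_lapP_eq0 mx2 my2); first exact: subvsP.
  have : h%:C^-1 *: ((Gstar_mx mx my 1)^T *m vsval p) = 0 by rewrite -Au u0 linear0.
  by move=> /eqP; rewrite scaler_eq0 invr_eq0 (negPf hn) => /eqP ->; rewrite mulmx0.
have ep' := congr1 vsval ep; rewrite linearD !linearZ /= sE in ep'.
have e : (Gstar_mx mx my 1)^T *m vsval q +
    eps%:C ^+ 2 *: (h%:C^-1 *: ((Gstar_mx mx my 1)^T *m (Gstar_mx mx my 1 *m u))) =
    l *: ((Gstar_mx mx my 1)^T *m vsval p).
  move: (congr1 (mulmx (Gstar_mx mx my 1)^T) ep'); move: (Gstar_mx mx my 1) => G1.
  by rewrite mulmxDr -!scalemxAr.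
(* The factors d / h and 1 / h absorb the powers of h, giving the equations their form for h = 1. *)
apply: (complex_eigen_bounds mx2 my2 (u := u) (p := (d%:C / h%:C) *: vsval p)
  (phi := h%:C^-1 *: vsval q) hinf lam0 d_gt0 un).
- by rewrite -scaled_velA Au -scalemxAr scalerA.
- rewrite -scaled_velA Au.
  have scale1 (z : velocity R[i] mx my) :
      l *: (d%:C *: (h%:C^-1 *: z)) = (d%:C / h%:C) *: (l *: z).
    by rewrite !scalerA; congr (_ *: _); ring.
  have scale2 (y z : velocity R[i] mx my) :
      (d%:C / h%:C) *: (y + eps%:C ^+ 2 *: (h%:C^-1 *: z)) = d%:C *: (h%:C^-1 *: y) + z.
    rewrite scalerDr !scalerA dE; congr (_ + _).
    by rewrite -[RHS]scale1r; congr (_ *: _); field; rewrite hn en.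
  by rewrite scale1 -e scale2 -scalemxAr.
- have := congr1 vsval (lker0_lfunVK lker_lapP (schur mx my h%:C eps%:C p)).
  rewrite lapPE sE -/q -scalemxAr => /(congr1 (fun v => h%:C *: v)).
  rewrite !scalerA mulfV // scale1r => <-; rewrite -!scalemxAr; congr (_ *: _).
  by field.
Qed.
End Spectrum.

(* An order relation x <= y in R[i] entails that y - x is real, so that the   *)
(* bounds below also assert that the eigenvalues are real.                    *)
Theorem theorem3p5 (R : realType) (a b : R) (a_gt0 : 0 < a) (b_gt0 : 0 < b)
    (refinement : set (mesh a b)) (beta : R) (beta_gt0 : 0 < beta)
    (beta_inf_sup : forall g : mesh a b, refinement g -> inf_sup g beta) :
  (exists c C : R, [/\ 0 < c, 0 < C &
     forall (g : mesh a b) (eps : R) (lambda : R[i]),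
       refinement g -> 0 < eps -> eigenvalue_P1M g eps lambda ->
       c%:C <= lambda <= C%:C]) /\
  (forall (g : mesh a b) (eps : R) (lambda : R[i]),
     refinement g -> 0 < eps -> eigenvalue_schur g eps lambda ->
     (beta ^+ 2)%:C <= lambda <= 1).
Proof.
have schur_bounds (g : mesh a b) (eps : R) (lambda : R[i]) :
     refinement g -> 0 < eps -> eigenvalue_schur g eps lambda ->
     (beta ^+ 2)%:C <= lambda <= 1.
  move=> rg eps0; apply: schur_eigenvalue_bounds; rewrite ?sqr_ge0 //.
  - exact: nx_ge2.
  - exact: ny_ge2.
  - exact: h_gt0.
  - exact: discrete_inf_sup_sqr (beta_inf_sup g rg).
(* The minimum with 1 accommodates the possible eigenvalue 1 of the velocity block. *)
split=> //; exists (Num.min (beta ^+ 2) 1), 1; split=> //.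
  by rewrite lt_min exprn_gt0 // ltr01.
move=> g eps lambda rg eps0.
have kerA := lker_velA (nx_ge2 g) (ny_ge2 g) (h_gt0 g) eps0.
have kerL := lker_lapP (nx_ge2 g) (ny_ge2 g) (h_gt0 g).
case/(P1M_eigenvalue kerA kerL).
- by move=> ->; rewrite -[1 in X in _ <= X <= _](rmorph1 (real_complex R)) !lecR ge_min lexx orbT.
- move=> /(schur_bounds _ _ _ rg eps0) /andP[le1 le2]; apply/andP; split=> //.
  by apply: le_trans le1; rewrite lecR ge_min lexx.
Qed.
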